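(* For every constant $c>0$ (and every fixed constant $\beta$ with the graphs below satisfying $\mathrm{sd}(G)\le\beta n^{1/3}$), there is an algorithm that, given an $n$-vertex graph $G$ of symmetric difference $O(n^{1/3})$, outputs an sd-degeneracy sequence of $G$ of width $O(n^{1/3}\log n)$, in time $O(n^{7/3}\log n)$ with probability at least $1-n^{-c}$.
   Context: For $u,v\in V(G)$, $\mathrm{sd}_G(u,v)=|(N_G(u)\setminus\{v\})\triangle(N_G(v)\setminus\{u\})|$. The symmetric difference $\mathrm{sd}(G)$ is the least nonnegative integer $d$ such that every induced subgraph $H$ of $G$ with at least two vertices has $u\neq v$ with $\mathrm{sd}_H(u,v)\le d$. An sd-degeneracy sequence of an $n$-vertex graph $G$ is a list $(u_1,v_1),\dots,(u_{n-1},v_{n-1})$ with $u_i\neq v_i$, $V(G)=\{u_1,\dots,u_{n-1},v_{n-1}\}$, and no $i<j$ with $u_i\in\{u_j,v_j\}$; its width is $\max_{i}\mathrm{sd}_{G-\{u_1,\dots,u_{i-1}\}}(u_i,v_i)$. *)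

(* Defs.v *)
From HB Require Import structures.
From mathcomp Require Import all_boot all_order all_algebra.
From mathcomp Require Import all_classical all_reals all_analysis.

Set Implicit Arguments.
Unset Strict Implicit.
Unset Printing Implicit Defensive.

Import Order.TTheory GRing.Theory Num.Theory.

Record sgraph (T : finType) := SGraph {
  adj :> rel T;
  adj_sym : symmetric adj;
  adj_irr : irreflexive adj }.

Section SymmetricDifference.
Variables (T : finType) (G : sgraph T).
Implicit Types (A : {set T}) (u v : T) (s : seq (T * T)).

(* An induced subgraph is given by its vertex set A; [nbh_in A] and [sd_in A]
   are N_H and sd_H for H = G[A]. *)
Definition nbh_in A u : {set T} := [set w in A | adj G u w].

Definition symdiff A B : {set T} := (A :\: B) :|: (B :\: A).

Definition sd_in A u v : nat :=
  #|symdiff (nbh_in A u :\ v) (nbh_in A v :\ u)|.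

Definition sd_at_most (d : nat) : bool :=
  [forall A : {set T}, (1 < #|A|) ==>
    [exists u in A, exists v in A, (u != v) && (sd_in A u v <= d)]].

Lemma sd_at_most_exists : exists d, sd_at_most d.
Proof.
exists #|T|; apply/forallP => A; apply/implyP => /card_gt1P[u [v [uA vA uv]]].
apply/existsP; exists u; rewrite uA; apply/existsP; exists v.
by rewrite vA uv max_card.
Qed.

Definition sd : nat := ex_minn sd_at_most_exists.

(* In the last clause [last x (unzip2 s)] is the second component of the last
   pair of s as soon as s is nonempty. *)
Definition sd_degeneracy_seq s : Prop :=
  [/\ size s = #|T|.-1,
      all (fun p => p.1 != p.2) s,
      pairwise (fun p q => (p.1 != q.1) && (p.1 != q.2)) s &
      forall x : T, (x \in unzip1 s) || (x == last x (unzip2 s))].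

Definition sd_width s : nat :=
  \max_(i < size s)
    sd_in (~: [set x in take i (unzip1 s)])
          (tnth (in_tuple s) i).1 (tnth (in_tuple s) i).2.

End SymmetricDifference.

(* Randomized word RAM, programmed in a structured language.  A machine has
   registers and finitely many (as many as the program mentions) arrays of
   memory cells, all holding words of [w] bits.  Every instruction, every
   sequencing and every evaluation of a test costs one time unit. *)
Inductive binop := OpAdd | OpSub | OpMul | OpDiv | OpMod | OpLt | OpEq.

Inductive cmd :=
  | CSkip
  | CConst of nat & nat            (* CConst x k  : x := k *)
  | COp of binop & nat & nat & nat (* COp o x y z : x := y o z *)
  | CRead of nat & nat & nat       (* CRead x a y : x := a[y] *)
  | CWrite of nat & nat & nat      (* CWrite a x y : a[x] := y *)
  | CRand of nat & nat             (* CRand x y   : x := uniform in [0, y) *)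
  | CSeq of cmd & cmd
  | CIf of nat & cmd & cmd         (* tests whether the register is nonzero *)
  | CWhile of nat & cmd.

Record state := State { reg : nat -> nat; cell : nat -> nat -> nat }.

Definition upd (V : Type) (f : nat -> V) (x : nat) (v : V) : nat -> V :=
  fun y => if y == x then v else f y.

Definition set_reg (st : state) (x v : nat) : state :=
  State (upd (reg st) x v) (cell st).

Definition set_mem (st : state) (a i v : nat) : state :=
  State (reg st) (upd (cell st) a (upd (cell st a) i v)).

(* [OpSub] is truncated at 0; division by 0 follows [divn] and [modn]. *)
Definition eval_binop (o : binop) (y z : nat) : nat :=
  match o with
  | OpAdd => y + z
  | OpSub => y - z
  | OpMul => y * z
  | OpDiv => y %/ z
  | OpMod => y %% z
  | OpLt => y < z
  | OpEq => y == z
  end.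

(* A configuration is the stack of commands still to be executed, together with
   the state; it is halted when the stack is empty. *)
Definition config : Type := seq cmd * state.

(* The equiprobable successors of the configuration [(c :: k, st)]; there is
   exactly one unless c is a [CRand].  Drawing from an empty range yields 0. *)
Definition step (w : nat) (c : cmd) (k : seq cmd) (st : state) : seq config :=
  match c with
  | CSkip => [:: (k, st)]
  | CConst x m => [:: (k, set_reg st x (m %% 2 ^ w))]
  | COp o x y z =>
      [:: (k, set_reg st x (eval_binop o (reg st y) (reg st z) %% 2 ^ w))]
  | CRead x a y => [:: (k, set_reg st x (cell st a (reg st y)))]
  | CWrite a x y => [:: (k, set_mem st a (reg st x) (reg st y))]
  | CRand x y => [seq (k, set_reg st x r) | r <- iota 0 (maxn 1 (reg st y))]
  | CSeq c1 c2 => [:: (c1 :: c2 :: k, st)]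
  | CIf x c1 c2 => [:: ((if reg st x != 0 then c1 else c2) :: k, st)]
  | CWhile x c1 =>
      [:: (if reg st x != 0 then c1 :: CWhile x c1 :: k else k, st)]
  end.

(* Probability that, from the given configuration, the machine halts within t
   steps in a state satisfying Q. *)
Fixpoint prob_within (R : realType) (w t : nat) (Q : state -> Prop)
    (k : seq cmd) (st : state) : R :=
  match k, t with
  | [::], _ => (`[< Q st >])%:R%R
  | _ :: _, 0 => 0%R
  | c :: k', t'.+1 =>
      let next := step w c k' st in
      ((\sum_(cf <- next) prob_within R w t' Q cf.1 cf.2) / (size next)%:R)%R
  end.

(* Words of Theta(log n) bits; the constant K is a parameter of the machine. *)
Definition word_bits (K n : nat) : nat := K * up_log 2 n.

(* Input: register 0 holds n and array 0 the adjacency matrix of G, row by row;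
   everything else is 0. *)
Definition input_state (n : nat) (G : sgraph 'I_n) : state :=
  State (fun x => if x == 0 then n else 0)
        (fun a j => if a == 0 then
           nat_of_bool [exists u : 'I_n, exists v : 'I_n,
                          (j == u * n + v) && adj G u v]
         else 0).

(* Output: the first 2 (n - 1) cells u_1, v_1, u_2, v_2, ... of array 1. *)
Definition outputs (n : nat) (st : state) (s : seq ('I_n * 'I_n)) : Prop :=
  [seq (nat_of_ord p.1, nat_of_ord p.2) | p <- s] =
  [seq (cell st 1 (2 * i), cell st 1 (2 * i + 1)) | i <- iota 0 n.-1].

(* Main.v *)
(** Let [k] be the cube root of [n], rounded up.  A round draws [k^2] vertices at
    random and groups the remaining vertices by their adjacency to the drawn
    vertices that remain; in every group all vertices but the smallest one are
    removed, each paired with the smallest one.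

    Two vertices whose neighbourhoods differ in more than [C n^(1/3) ln n]
    remaining vertices end up in the same group with probability at most
    [n^(-C)], which bounds the width.  On the other hand, as long as many
    vertices remain, the bound on sd(G) yields [k] disjoint pairs whose
    neighbourhoods differ in [O(k)] vertices; each of them ends up in one group
    with probability at least a constant [p].  Hence [exp(m / k)], where [m] is
    the number of remaining vertices, shrinks in expectation by the factor
    [1 - p / 2] in every round, and [O(k^2)] rounds leave [O(k)] vertices, which
    can be removed in any order.  A round takes time [O(n k^2)] by partition
    refinement.

    The machine draws all the samples first, so that the remaining computation is
    deterministic and its success is a property of the sample sequence. *)

Require Import Defs.
From HB Require Import structures.
From mathcomp Require Import all_boot all_order all_algebra.
From mathcomp Require Import all_classical all_reals all_analysis.
From mathcomp Require Import ring lra zify.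
From mathcomp Require Import fintype finset.

Set Implicit Arguments.
Unset Strict Implicit.
Unset Printing Implicit Defensive.

Import Order.TTheory GRing.Theory Num.Theory.

(** * Traces of vertices on a sample *)

Section Traces.
Variables (T : finType) (G : sgraph T).
Implicit Types (A B : {set T}) (u v : T) (s : seq T) (ps : seq (T * T)).

(** Unlike in [sd_in], the vertices [u] and [v] themselves may count, so that two vertices agree on
    a sample exactly when the sample misses this set. *)
Definition distinguishers A u v : {set T} :=
  [set x in A | adj G x u != adj G x v].

(** The samples are drawn in advance from all vertices; a drawn vertex outside [A] is never a
    distinguisher and hence has no effect. *)
Definition same_trace A s u v : bool :=
  all (fun x => x \notin distinguishers A u v) s.

Lemma same_traceP A s u v :
  reflect {in s, forall x, x \in A -> adj G x u = adj G x v}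
          (same_trace A s u v).
Proof.
apply: (iffP allP) => h x xs.
  by move=> xA; have := h x xs; rewrite inE xA /= negbK => /eqP.
by rewrite inE negb_and negbK; case: (boolP (x \in A)) => //= xA; rewrite h.
Qed.

Lemma same_trace_refl A s u : same_trace A s u u.
Proof. exact/same_traceP. Qed.

Lemma same_trace_sym A s u v : same_trace A s u v -> same_trace A s v u.
Proof. by move/same_traceP=> h; apply/same_traceP => x xs xA; rewrite h. Qed.

Lemma same_trace_trans A s v u w :
  same_trace A s u v -> same_trace A s v w -> same_trace A s u w.
Proof.
move=> /same_traceP h1 /same_traceP h2; apply/same_traceP => x xs xA.
by rewrite h1 // h2.
Qed.

Lemma same_trace_rcons A s x u v : x \in A ->
  same_trace A (rcons s x) u v =
  same_trace A s u v && (adj G x u == adj G x v).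
Proof. by move=> xA; rewrite /same_trace all_rcons inE xA /= negbK andbC. Qed.

Lemma same_trace_rcons_notin A s x u v : x \notin A ->
  same_trace A (rcons s x) u v = same_trace A s u v.
Proof. by move=> xA; rewrite /same_trace all_rcons inE (negbTE xA). Qed.

(** Traces are taken in the set [A] at the start of a round, but vertices leave one by one during
    it; this passes to the set [B] present at a removal. *)
Lemma sd_in_le_distinguishers A B u v :
  B \subset A -> sd_in G B u v <= #|distinguishers A u v|.
Proof.
move=> /subsetP sBA; apply/subset_leq_card/subsetP => w.
rewrite !inE !(adj_sym G w).
case: (boolP (w \in B)) => [/sBA ->|]; last by rewrite !andbF.
case: eqP => [->|_]; case: eqP => [->|_]; rewrite ?adj_irr //=;
  by case: (adj G u _); case: (adj G v _).
Qed.

(** The 2 accounts for [u] and [v], which [sd_in] leaves out. *)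
Lemma distinguishers_le_sd_in A B u v :
  #|distinguishers A u v| <= sd_in G B u v + 2 + #|A :\: B|.
Proof.
have sub : distinguishers A u v \subset
   symdiff (nbh_in G B u :\ v) (nbh_in G B v :\ u) :|: [set u; v] :|: A :\: B.
  apply/subsetP => w; rewrite !inE !(adj_sym G w) => /andP[-> ne].
  case: (w \in B); rewrite ?orbT //= ?andbT.
  move: ne; case: (w == u); case: (w == v); rewrite ?orbT //=;
    by case: (adj G u w); case: (adj G v w).
apply: leq_trans (subset_leq_card sub) _.
apply: leq_trans (leq_card_setU _ _) _; rewrite leq_add2r.
apply: leq_trans (leq_card_setU _ _) _; rewrite leq_add2l.
by rewrite cards2; case: (u != v).
Qed.

Definition endpoints ps : seq T := flatten [seq [:: p.1; p.2] | p <- ps].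

Lemma size_endpoints ps : size (endpoints ps) = 2 * size ps.
Proof. by elim: ps => //= p ps; rewrite /endpoints /= => ->; lia. Qed.

(* Deleting 2j vertices changes a symmetric difference by at most 2j, so the
   pairs supplied by the induced subgraphs can be taken disjoint. *)
Lemma disjoint_close_pairs A d j : sd_at_most G d -> 2 * j <= #|A| ->
  exists ps, [/\ size ps = j, uniq (endpoints ps), {subset endpoints ps <= A}
    & forall p, p \in ps -> #|distinguishers A p.1 p.2| <= d + 2 * j].
Proof.
move=> sdG; elim: j => [|j IH] jA; first by exists [::].
have [|ps [sz un sub close]] := IH; first by lia.
pose B := A :\: [set x in endpoints ps].
have cI : #|A :&: [set x in endpoints ps]| <= 2 * j.
  apply: leq_trans (subset_leq_card (subsetIr _ _)) _.
  rewrite cardsE; apply: leq_trans (card_size _) _.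
  by rewrite size_endpoints sz.
have cB : 1 < #|B|.
  by have := cardsID [set x in endpoints ps] A; rewrite -/B; lia.
have /forallP/(_ B)/implyP/(_ cB)/existsP[u /andP[uB]] := sdG.
case/existsP=> v /and3P[vB uv close_uv].
have sBA : B \subset A by apply: subsetDl.
have AB : A :\: B = A :&: [set x in endpoints ps] by rewrite /B setDDr setDv set0U.
exists ((u, v) :: ps); split => //=; first by rewrite sz.
- move: uB vB; rewrite !inE negb_or uv => /andP[-> _] /andP[-> _] /=.
  exact: un.
- move=> x; rewrite !inE => /or3P[/eqP->|/eqP->|/sub//].
    exact: (subsetP sBA).
  exact: (subsetP sBA).
move=> p; rewrite inE => /orP[/eqP->|/close]; last first.
  by move=> h; apply: leq_trans h _; lia.
(* The new pair costs [d] in [B], 2 for its own vertices and [2 * j] for the earlier endpoints. *)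
apply: leq_trans (distinguishers_le_sd_in A B u v) _.
by rewrite AB; move: cI close_uv => *; lia.
Qed.

(** Each counted pair is charged to one of its endpoints in [B]. Disjointness allows deleting that
    endpoint from [B] without changing the count of the other pairs. *)
Lemma count_endpoints_le B ps : uniq (endpoints ps) ->
  count (fun p => (p.1 \in B) || (p.2 \in B)) ps <= #|B|.
Proof.
elim: ps B => [|p ps IH] B //= /and3P[].
rewrite -/(endpoints ps) inE negb_or => /andP[_ n1] n2 un.
have key z : z \in B -> z \notin endpoints ps ->
    count (fun p => (p.1 \in B) || (p.2 \in B)) ps < #|B|.
  move=> zB zn; rewrite (cardsD1 z) zB add1n ltnS.
  apply: leq_trans (IH (B :\ z) un); apply: eq_leq; apply: eq_in_count => q qps.
  have [q1 q2] : q.1 \in endpoints ps /\ q.2 \in endpoints ps.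
    by split; apply/flatten_mapP; exists q => //; rewrite !inE eqxx ?orbT.
  have ne y : y \in endpoints ps -> y != z.
    by move=> yi; apply: contraNneq zn => <-.
  by rewrite !inE !ne.
case: (boolP (_ \in B)) => [/key/(_ n1)|_] //=.
by case: (boolP (_ \in B)) => [/key/(_ n2)|_] //=; rewrite add0n; apply: IH.
Qed.

End Traces.

(** * Survivors of a round and partial sd-degeneracy sequences *)

Section Survivors.
Variables (n : nat) (G : sgraph 'I_n).
Implicit Types (A B : {set 'I_n}) (s : seq 'I_n) (L : seq ('I_n * 'I_n)).

Definition is_rep A s (v r : 'I_n) : Prop :=
  [/\ r \in A, same_trace G A s r v &
      {in A, forall w, same_trace G A s w v -> r <= w}].

Definition survivors A s : {set 'I_n} :=
  [set v in A | [forall w in A, same_trace G A s w v ==> (v <= w)]].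

Lemma survivors_sub A s : survivors A s \subset A.
Proof. by apply/subsetP => v; rewrite inE => /andP[]. Qed.

Lemma mem_survivors A s v r : v \in A -> is_rep A s v r ->
  (v \in survivors A s) = (r == v).
Proof.
move=> vA [rA rv rmin]; rewrite inE vA /=; apply/forall_inP/eqP => [h|<- w wA].
  apply/val_inj/eqP; rewrite eqn_leq /= (implyP (h r rA) rv) andbT.
  exact: rmin (same_trace_refl _ _ _ _).
by apply/implyP => wr; apply: rmin => //; apply: same_trace_trans wr rv.
Qed.

Lemma rep_survives A s v r : is_rep A s v r -> r \in survivors A s.
Proof.
move=> [rA rv rmin]; rewrite inE rA; apply/forall_inP => w wA; apply/implyP => wr.
by apply: rmin => //; apply: same_trace_trans wr rv.
Qed.

Lemma is_rep_transfer A s u v r :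
  same_trace G A s u v -> is_rep A s u r -> is_rep A s v r.
Proof.
move=> uv [rA ru rmin]; split => //; first exact: same_trace_trans ru uv.
by move=> w wA wv; apply: rmin => //; apply: same_trace_trans wv (same_trace_sym uv).
Qed.

Lemma is_rep_inj A s v r r' : is_rep A s v r -> is_rep A s v r' -> r = r'.
Proof.
move=> [rA rv rmin] [rA' rv' rmin']; apply/val_inj/eqP.
by rewrite eqn_leq /= rmin // rmin'.
Qed.

(** Of two vertices with equal traces the larger one is removed, so the removed vertices meet every
    agreeing pair, and the pairs are disjoint. *)
Lemma count_agreeing_le A s (ps : seq ('I_n * 'I_n)) :
  uniq (endpoints ps) -> {subset endpoints ps <= A} ->
  count (fun p => same_trace G A s p.1 p.2) ps + #|survivors A s| <= #|A|.
Proof.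
move=> un sub; have := cardsID (survivors A s) A.
rewrite (setIidPr (survivors_sub A s)) => <-; rewrite addnC leq_add2l.
apply: leq_trans (count_endpoints_le _ un); elim: ps un sub => //= p ps IH.
rewrite -/(endpoints ps) inE negb_or => /and3P[/andP[p12 _] _ un] sub.
have [p1A p2A] : p.1 \in A /\ p.2 \in A.
  by split; apply: sub; rewrite !inE eqxx ?orbT.
apply: leq_add; last by apply: IH => // x xe; apply: sub; rewrite !inE xe !orbT.
case: (boolP (same_trace _ _ _ _ _)) => //= st; rewrite lt0b !inE p1A p2A /= !andbT.
rewrite -negb_and; apply/negP => /andP[/forall_inP h1 /forall_inP h2].
move/negP: p12; apply; apply/eqP/val_inj/eqP; rewrite eqn_leq /=.
by rewrite (implyP (h1 _ p2A)) ?(same_trace_sym st) // (implyP (h2 _ p1A)).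
Qed.

(** Invariant of the output: [L] lists the removals so far and [B] the vertices left. The clause on
    [last] is vacuous for empty [L], and otherwise says that the latest partner is still present. *)
Definition sd_prefix (W : nat) L B : Prop :=
  [/\ B = ~: [set x in unzip1 L],
      all (fun p => p.1 != p.2) L,
      pairwise (fun p q => (p.1 != q.1) && (p.1 != q.2)) L,
      {in B, forall x, last x (unzip2 L) \in B} &
      sd_width G L <= W].

Lemma sd_prefix_nil W : sd_prefix W [::] [set: 'I_n].
Proof.
split => //; last by rewrite /sd_width big_ord0.
by apply/setP => x; rewrite !inE.
Qed.

Lemma sd_width_rcons L p : sd_width G (rcons L p) =
  maxn (sd_width G L) (sd_in G (~: [set x in unzip1 L]) p.1 p.2).
Proof.
have E l : sd_width G l = \max_(i < size l)
    sd_in G (~: [set x in take i (unzip1 l)]) (nth p l i).1 (nth p l i).2.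
  by apply: eq_bigr => i _; rewrite (tnth_nth p).
rewrite !E size_rcons big_ord_recr /= nth_rcons ltnn eqxx /unzip1 map_rcons.
congr maxn; last by rewrite -cats1 take_size_cat ?size_map.
apply: eq_bigr => i _; rewrite nth_rcons ltn_ord -cats1 takel_cat //.
by rewrite size_map ltnW.
Qed.

Lemma sd_prefix_rcons W L B u v : sd_prefix W L B ->
  u \in B -> v \in B -> u != v -> sd_in G B u v <= W ->
  sd_prefix W (rcons L (u, v)) (B :\ u).
Proof.
case=> EB ne pw lst wid uB vB uv close; split.
- apply/setP => x; rewrite EB /unzip1 map_rcons !inE mem_rcons inE.
  by rewrite negb_or.
- by rewrite all_rcons ne andbT.
- rewrite -cats1 pairwise_cat pw /= andbT allrel1r.
  apply/allP => p pL; have pB : p.1 \notin B.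
    by rewrite EB !inE negbK; apply: map_f.
  by apply/andP; split; apply: contraNneq pB => ->.
- by move=> x _; rewrite /unzip2 map_rcons last_rcons !inE eq_sym uv vB.
by rewrite sd_width_rcons -EB geq_max wid.
Qed.

Lemma sd_prefix_uniq W L B : sd_prefix W L B -> uniq (unzip1 L).
Proof.
case=> _ _ pw _ _; rewrite uniq_pairwise pairwise_map.
by apply: sub_pairwise pw => p q /andP[].
Qed.

Lemma sd_prefix_size W L B : sd_prefix W L B -> size L + #|B| = n.
Proof.
move=> h; have un := sd_prefix_uniq h; case: h => -> _ _ _ _.
have := cardsC [set x in unzip1 L]; rewrite card_ord => E.
by rewrite -[RHS]E; congr addn; rewrite cardsE (card_uniqP un) size_map.
Qed.

(** The latest partner lies in [[set r]], so it is the one vertex that does not occur as a first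
    component. *)
Lemma sd_prefix_total W L r : sd_prefix W L [set r] ->
  sd_degeneracy_seq L /\ sd_width G L <= W.
Proof.
move=> h; have sz := sd_prefix_size h; have := h.
case=> EB ne pw lst wid; split => //; split => //.
  by rewrite card_ord -[X in X.-1]sz cards1 addn1.
move=> x; case: (boolP (x \in unzip1 L)) => //= xL.
have xr : x \in [set r] by rewrite EB !inE.
by have := lst x xr; rewrite inE => /eqP->; move: xr; rewrite inE.
Qed.

End Survivors.
(** * Random samples *)

Section Average.
Local Open Scope ring_scope.
Variables (R : realType) (n : nat).
Implicit Types (f g : seq 'I_n -> R) (D : {set 'I_n}).

(** Expectation over [m] independent uniform draws; the recursion follows the machine, which draws
    one vertex after the other. *)
Fixpoint avg (m : nat) f : R :=
  if m is m'.+1 then (\sum_(i < n) avg m' (fun s => f (i :: s))) / n%:R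
  else f [::].

Lemma le_avg m f g : (forall s, size s = m -> f s <= g s) -> avg m f <= avg m g.
Proof.
elim: m f g => [|m IH] f g fg /=; first exact: fg.
apply: ler_wpM2r; first by rewrite invr_ge0 ler0n.
by apply: ler_sum => i _; apply: IH => s sz; apply: fg; rewrite /= sz.
Qed.

Lemma eq_avg m f g : (forall s, size s = m -> f s = g s) -> avg m f = avg m g.
Proof. by move=> fg; apply: le_anti; rewrite !le_avg // => s /fg->. Qed.

Lemma avgD m f g : avg m (fun s => f s + g s) = avg m f + avg m g.
Proof.
elim: m f g => //= m IH f g; rewrite -mulrDl -big_split.
by under eq_bigr => i _ do rewrite IH.
Qed.

Lemma avgZ m a f : avg m (fun s => a * f s) = a * avg m f.
Proof.
elim: m f => //= m IH f; rewrite mulrA mulr_sumr.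
by under eq_bigr => i _ do rewrite IH.
Qed.

Lemma avg_sum (I : Type) (r : seq I) m (F : I -> seq 'I_n -> R) :
  avg m (fun s => \sum_(i <- r) F i s) = \sum_(i <- r) avg m (F i).
Proof.
elim: r => [|i r IH].
  rewrite big_nil -[RHS](mul0r (avg m (fun=> 0))) -avgZ.
  by apply: eq_avg => s _; rewrite big_nil mul0r.
by rewrite big_cons -IH -avgD; apply: eq_avg => s _; rewrite big_cons.
Qed.

Lemma avg_cat a b f :
  avg (a + b) f = avg a (fun s => avg b (fun s' => f (s ++ s'))).
Proof.
by elim: a f => //= a IH f; under eq_bigr => i _ do rewrite IH.
Qed.

Hypothesis n_gt0 : (0 < n)%N.

Lemma avg_cst m (a : R) : avg m (fun=> a) = a.
Proof.
elim: m => //= m ->; rewrite sumr_const card_ord -[a *+ n]mulr_natr mulfK //.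
by rewrite pnatr_eq0 -lt0n.
Qed.

(** The draws are independent, and each misses [D] with probability [1 - #|D| / n]. *)
Lemma avg_avoid m D :
  avg m (fun s => (all (fun x => x \notin D) s)%:R) = (1 - #|D|%:R / n%:R) ^+ m.
Proof.
have n0 : n%:R != 0 :> R by rewrite pnatr_eq0 -lt0n.
elim: m => //= m IH; rewrite exprS -IH.
under eq_bigr => i _ do under eq_avg => s _ do rewrite -mulnb natrM.
under eq_bigr => i _ do rewrite avgZ.
rewrite -mulr_suml -mulrA mulrCA mulrC; congr (_ * _).
have -> : \sum_(i < n) (i \notin D)%:R = n%:R - #|D|%:R :> R.
  apply/eqP; rewrite eq_sym subr_eq -natr_sum -natrD eqr_nat.
  rewrite -[X in X == _]card_ord -(cardC (mem D)) addnC eqn_add2r.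
  rewrite -sum1_card big_mkcond; apply/eqP/eq_bigr => i _; rewrite inE.
  by case: (_ \in _).
by rewrite mulrBl divff.
Qed.

End Average.

(** * Probability that a sample sequence makes all rounds succeed *)

Section Sampling.
Local Open Scope ring_scope.
Variables (R : realType) (n : nat) (G : sgraph 'I_n).
Hypothesis n_gt0 : (0 < n)%N.
Implicit Types (A : {set 'I_n}) (s w : seq 'I_n).

Definition separates (W : nat) A s : bool :=
  [forall u in A, forall v in A,
     same_trace G A s u v ==> (#|distinguishers G A u v| <= W)%N].

(** Success of [N] rounds as a deterministic property of the draws: each round consumes the next [t]
    of them, and at most [th] vertices may be left at the end. *)
Fixpoint well_sampled (W th t N : nat) A w : bool :=
  if N is N'.+1 then
    separates W A (take t w) &&
    well_sampled W th t N' (survivors G A (take t w)) (drop t w)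
  else (#|A| <= th)%N.

(** Union bound over all ordered pairs: a pair with more than [W] distinguishers has equal traces
    only if all [t] draws miss them. *)
Lemma separates_fail_le (eps : R) W t A :
  (forall d, (W < d <= n)%N -> (1 - d%:R / n%:R) ^+ t <= eps) -> 0 <= eps ->
  avg t (fun s => (~~ separates W A s)%:R) <= n%:R ^+ 2 * eps.
Proof.
move=> Heps eps0.
pose far (p : 'I_n * 'I_n) := (W < #|distinguishers G A p.1 p.2|)%N.
apply: (@le_trans _ _ (avg t (fun s => \sum_(p : 'I_n * 'I_n)
    (far p && same_trace G A s p.1 p.2)%:R))).
  apply: le_avg => s _; case: (boolP (separates W A s)) => /= [_|].
    by apply: sumr_ge0 => p _; apply: ler0n.
  rewrite negb_forall_in => /existsP[u /andP[uA]].
  rewrite negb_forall_in => /existsP[v /andP[vA]].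
  rewrite negb_imply -ltnNge => /andP[tr far_uv].
  rewrite (bigD1 (u, v)) //= {1}/far /= far_uv tr lerDl.
  by apply: sumr_ge0 => p _; apply: ler0n.
rewrite avg_sum.
apply: (@le_trans _ _ (\sum_(p : 'I_n * 'I_n) eps)); last first.
  by rewrite sumr_const card_prod !card_ord -[eps *+ _]mulr_natl natrM expr2.
apply: ler_sum => p _; case: (boolP (far p)) => /= [fp|_]; last first.
  by rewrite avg_cst.
rewrite avg_avoid //; apply: Heps; apply/andP; split=> //.
by apply: leq_trans (max_card _) _; rewrite card_ord.
Qed.

(** The potential [expR (lam * #|A|)] shrinks by the factor [q] per round in expectation, as in
    Markov's inequality; the separation failures of the [N] rounds add up to at most [N * delta]. *)
Lemma well_sampled_ge (W th t N : nat) (q delta lam : R) A :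
  0 <= q -> 0 <= lam ->
  (forall A, avg t (fun s => (~~ separates W A s)%:R) <= delta) ->
  (forall A, (th < #|A|)%N ->
     avg t (fun s => expR (lam * #|survivors G A s|%:R)) <=
     q * expR (lam * #|A|%:R)) ->
  1 - q ^+ N * expR (lam * #|A|%:R) - N%:R * delta <=
    avg (N * t) (fun w => (well_sampled W th t N A w)%:R).
Proof.
move=> q0 lam0 Hdelta Hq.
(* Contraction is only assumed above [th], so the potential is cut to 0 below; it stays 0 because
   survivors form a subset. *)
pose phi A : R := if (th < #|A|)%N then expR (lam * #|A|%:R) else 0.
have phi_le B : phi B <= expR (lam * #|B|%:R).
  by rewrite /phi; case: ifP => // _; apply: expR_ge0.
have phi_step B : avg t (fun s => phi (survivors G B s)) <= q * phi B.
  case: (ltnP th #|B|) => cB.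
    rewrite {2}/phi cB; apply: le_trans (Hq _ cB).
    by apply: le_avg => s _; apply: phi_le.
  rewrite {2}/phi ltnNge cB /= mulr0 -[leRHS](@avg_cst _ _ n_gt0 t).
  apply: le_avg => s _; rewrite /phi ltnNge (leq_trans _ cB) //.
  exact/subset_leq_card/survivors_sub.
suff {A} H A : 1 - q ^+ N * phi A - N%:R * delta <=
    avg (N * t) (fun w => (well_sampled W th t N A w)%:R).
  by apply: le_trans (H A); rewrite lerD2r lerD2l lerN2 ler_wpM2l // exprn_ge0.
elim: N A => [|N IH] A.
  rewrite expr0 mul1r mul0r subr0 /= /phi ltnNge.
  case: leqP => //= cA; first by rewrite subr0.
  (* With too many vertices left the potential is at least 1, so the claimed lower bound is not
     positive. *)
  by rewrite subr_le0 -expR0 ler_expR mulr_ge0.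
rewrite mulSn avg_cat.
apply: (@le_trans _ _ (avg t (fun s => (1 - N%:R * delta) +
   (- q ^+ N * phi (survivors G A s) + -1 * (~~ separates W A s)%:R)))).
  rewrite avgD (avg_cst n_gt0) avgD !avgZ.
  have := phi_step A; have := Hdelta A.
  set X := avg _ _; set Y := avg _ _ => hX hY.
  have : q ^+ N * Y <= q ^+ N * (q * phi A) by rewrite ler_wpM2l // exprn_ge0.
  by rewrite exprSr -natr1; lra.
apply: le_avg => s sz; under eq_avg => w _ do
  rewrite /= -[t in take t _]sz -[t in drop t _]sz take_size_cat // drop_size_cat //.
case: (separates W A s) => /=.
  by apply: le_trans (IH _); lra.
(* The bound from the induction hypothesis is at most 1, so subtracting 1 for the failed separation
   leaves at most 0. *)
rewrite avg_cst //; have := IH (survivors G A s).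
set Z := avg _ _ => hZ; have Z1 : Z <= 1.
  rewrite -[leRHS](@avg_cst _ _ n_gt0 (N * t)); apply: le_avg => w _.
  by rewrite lern1 leq_b1.
by lra.
Qed.

End Sampling.

(** * Reasoning about programs *)

(** Arithmetic takes register operands only, so register [1] has to hold one; [f] stores the outcome
    of the loop test. *)
Definition for_loop (i f m : nat) (body : cmd) : cmd :=
  CSeq (CConst i 0) (CSeq (COp OpLt f i m)
    (CWhile f (CSeq body (CSeq (COp OpAdd i i 1) (COp OpLt f i m))))).

Section ProgramLogic.
Variables (R : realType) (w : nat).
Implicit Types (c : cmd) (st : state) (Q Post : state -> Prop) (k : seq cmd).

Lemma prob_within_ge0 t Post k st : (0 <= prob_within R w t Post k st)%R.
Proof.
elim: t k st => [|t IH] [|c k] st /=; try exact: ler0n; first by [].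
by apply: divr_ge0; [apply: sumr_ge0 => cf _; apply: IH | apply: ler0n].
Qed.

Lemma prob_within_mono t t' Post k st : t <= t' ->
  (prob_within R w t Post k st <= prob_within R w t' Post k st)%R.
Proof.
elim: t t' k st => [|t IH] [|t'] [|c k] st //= tt'.
  by apply: divr_ge0; [apply: sumr_ge0 => cf _; apply: prob_within_ge0
                      | apply: ler0n].
apply: ler_wpM2r; first by rewrite invr_ge0 ler0n.
by apply: ler_sum => cf _; apply: IH.
Qed.

Lemma prob_within_imp t Post Post' k st : (forall st', Post st' -> Post' st') ->
  (prob_within R w t Post k st <= prob_within R w t Post' k st)%R.
Proof.
move=> imp; elim: t k st => [|t IH] [|c k] st //=.
- by case: asboolP => [/imp h|_]; rewrite ?ler0n // asboolT.
- by case: asboolP => [/imp h|_]; rewrite ?ler0n // asboolT.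
apply: ler_wpM2r; first by rewrite invr_ge0 ler0n.
by apply: ler_sum => cf _; apply: IH.
Qed.

(* [c] takes [st], without drawing random numbers on the way, to a state
   satisfying [Q] in at most [T] steps; quantifying over the continuation makes
   the rules compositional. *)
Definition runs (T : nat) c st Q : Prop := exists2 st', Q st' &
  forall Post k T', (prob_within R w T' Post k st' <=
                     prob_within R w (T + T') Post (c :: k) st)%R.

Lemma runs_weaken T T' c st Q Q' : runs T c st Q -> T <= T' ->
  (forall st', Q st' -> Q' st') -> runs T' c st Q'.
Proof.
move=> [st' Qst' h] TT' QQ'; exists st'; first exact: QQ'.
move=> Post k T1; apply: le_trans (h Post k T1) _.
by apply: prob_within_mono; rewrite leq_add2r.
Qed.

Lemma runs_le T T' c st Q : T <= T' -> runs T c st Q -> runs T' c st Q.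
Proof. by move=> TT' h; apply: runs_weaken h TT' _. Qed.

Lemma runs_step c st st' Q :
  (forall k, step w c k st = [:: (k, st')]) -> Q st' -> runs 1 c st Q.
Proof.
move=> E Qst'; exists st' => // Post k T'.
by rewrite add1n /= E big_seq1 divr1.
Qed.

Lemma runs_skip st Q : Q st -> runs 1 CSkip st Q.
Proof. exact: runs_step. Qed.

Lemma runs_const x m st Q : m < 2 ^ w -> Q (set_reg st x m) ->
  runs 1 (CConst x m) st Q.
Proof. by move=> mw; apply: runs_step => k /=; rewrite modn_small. Qed.

Lemma runs_op o x y z v st Q :
  eval_binop o (reg st y) (reg st z) = v -> v < 2 ^ w -> Q (set_reg st x v) ->
  runs 1 (COp o x y z) st Q.
Proof. by move=> E vw; apply: runs_step => k; rewrite [LHS]/= E modn_small. Qed.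

Lemma runs_read x a y v st Q : cell st a (reg st y) = v -> Q (set_reg st x v) ->
  runs 1 (CRead x a y) st Q.
Proof. by move=> <-; apply: runs_step. Qed.

Lemma runs_write a x y i v st Q : reg st x = i -> reg st y = v ->
  Q (Defs.set_mem st a i v) -> runs 1 (CWrite a x y) st Q.
Proof. by move=> <- <-; apply: runs_step. Qed.

Lemma runs_seq T1 T2 c1 c2 st Q :
  runs T1 c1 st (fun st1 => runs T2 c2 st1 Q) ->
  runs (T1 + T2).+1 (CSeq c1 c2) st Q.
Proof.
move=> [st1 [st2 Qst2 h2] h1]; exists st2 => // Post k T'.
apply: le_trans (h2 Post k T') _; apply: le_trans (h1 Post _ _) _.
by rewrite addSn /= big_seq1 divr1 addnA.
Qed.

Lemma runs_if T1 T2 x c1 c2 st Q :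
  (if reg st x != 0 then runs T1 c1 st Q else runs T2 c2 st Q) ->
  runs (maxn T1 T2).+1 (CIf x c1 c2) st Q.
Proof.
move=> h; have [st' Qst' h'] :
    runs (maxn T1 T2) (if reg st x != 0 then c1 else c2) st Q.
  by move: h; case: ifP => _ /runs_weaken; apply => //; rewrite leq_max leqnn ?orbT.
exists st' => // Post k T'; apply: le_trans (h' Post k T') _.
by rewrite addSn /= big_seq1 divr1.
Qed.

Lemma runs_while_stop x c st Q : reg st x = 0 -> Q st -> runs 1 (CWhile x c) st Q.
Proof. by move=> E; apply: runs_step => k /=; rewrite E. Qed.

Lemma runs_while_step T1 T2 x c st Q : reg st x != 0 ->
  runs T1 c st (fun st1 => runs T2 (CWhile x c) st1 Q) ->
  runs (T1 + T2).+1 (CWhile x c) st Q.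
Proof.
move=> E [st1 [st2 Qst2 h2] h1]; exists st2 => // Post k T'.
apply: le_trans (h2 Post k T') _; apply: le_trans (h1 Post _ _) _.
by rewrite addSn /= E big_seq1 divr1 addnA.
Qed.

(** The index of the invariant [J] counts completed iterations. Each iteration costs 5 beyond its
    body, for incrementing, testing and sequencing; the last 5 pays for the initialisation and the
    exit. *)
Lemma runs_for (J : nat -> state -> Prop) (b T i f m : nat) body st Q :
  b < 2 ^ w -> 1 < 2 ^ w -> uniq [:: i; f; m; 1] ->
  (forall j st, J j st -> reg st m = b /\ reg st 1 = 1) ->
  (forall j st v, J j st -> J j (set_reg st i v) /\ J j (set_reg st f v)) ->
  (forall j st, j < b -> J j st -> reg st i = j ->
     runs T body st (fun st' => J j.+1 st' /\ reg st' i = j)) ->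
  J 0 st -> (forall st', J b st' -> Q st') ->
  runs (b * (T + 5) + 5) (for_loop i f m body) st Q.
Proof.
move=> bw w1 un Jconst Jstab Jbody J0 JQ.
have [fi mi mf [f1 i1]] : [/\ i != f, m != i, m != f & 1 != f /\ 1 != i].
  rewrite !(eq_sym m) !(eq_sym 1); move: un => /and4P[].
  by rewrite !inE !negb_or => /and3P[-> -> ->] /andP[-> ->].
suff loop d j st1 : j + d = b -> J j st1 -> reg st1 i = j ->
    reg st1 f = (j < b) -> runs (d * (T + 5) + 1) (CWhile f (CSeq body
      (CSeq (COp OpAdd i i 1) (COp OpLt f i m)))) st1 Q.
  have -> : b * (T + 5) + 5 = (1 + (1 + (b * (T + 5) + 1)).+1).+1 by lia.
  apply: runs_seq; apply: runs_const; first exact: leq_trans w1.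
  have [J1 _] := Jstab _ _ 0 J0; have [Em _] := Jconst _ _ J1.
  apply: runs_seq; apply: (@runs_op _ _ _ _ (0 < b)).
  - by rewrite Em /= /upd eqxx.
  - by case: (0 < b); [|apply: leq_trans w1].
  apply: (loop b 0) => //; first exact: (Jstab _ _ _ J1).2.
    by rewrite /= /upd (negbTE fi) eqxx.
  by rewrite /= /upd eqxx.
elim: d j st1 => [|d IH] j st1 jd J1 Ei Ef.
  apply: runs_while_stop; first by rewrite Ef; case: ltnP => //; lia.
  by apply: JQ; rewrite -jd addn0.
have jb : j < b by lia.
have -> : d.+1 * (T + 5) + 1 = ((T + (1 + 1).+1).+1 + (d * (T + 5) + 1)).+1 by lia.
apply: runs_while_step; first by rewrite Ef jb.
apply: runs_seq; apply: runs_weaken (Jbody _ _ jb J1 Ei) (leqnn _) _.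
move=> st2 [J2 Ei2]; have [_ E1] := Jconst _ _ J2.
apply: runs_seq; apply: (@runs_op _ _ _ _ j.+1).
- by rewrite /= Ei2 E1 addn1.
- exact: leq_ltn_trans bw.
have [J3 _] := Jstab _ _ j.+1 J2; have [Em _] := Jconst _ _ J3.
apply: (@runs_op _ _ _ _ (j.+1 < b)).
- by rewrite Em /= /upd eqxx.
- by case: (_ < b); [|apply: leq_trans w1].
apply: (IH j.+1); [by rewrite addSnnS|exact: (Jstab _ _ _ J3).2| |];
  by rewrite /= /upd ?(negbTE fi) eqxx.
Qed.

End ProgramLogic.

(** * Registers and arrays left untouched *)

Section Frame.
Implicit Types (rs cs : seq nat) (st : state).

Definition frame rs cs st st' : Prop :=
  (forall x, x \notin rs -> reg st' x = reg st x) /\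
  (forall a, a \notin cs -> cell st' a = cell st a).

Lemma frame_refl rs cs st : frame rs cs st st.
Proof. by []. Qed.

Lemma frame_reg rs cs st st' x v : x \in rs ->
  frame rs cs st st' -> frame rs cs st (set_reg st' x v).
Proof.
move=> xrs [fr fc]; split => // y yrs /=; rewrite /upd.
by case: eqP yrs => [->|_ /fr->//]; rewrite xrs.
Qed.

Lemma frame_mem rs cs st st' a i v : a \in cs ->
  frame rs cs st st' -> frame rs cs st (Defs.set_mem st' a i v).
Proof.
move=> acs [fr fc]; split => // b bcs /=; rewrite /upd.
by case: eqP bcs => [->|_ /fc->//]; rewrite acs.
Qed.

Lemma frame_trans rs cs rs' cs' st st1 st2 :
  {subset rs' <= rs} -> {subset cs' <= cs} ->
  frame rs cs st st1 -> frame rs' cs' st1 st2 -> frame rs cs st st2.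
Proof.
move=> sr sc [fr fc] [fr' fc']; split => x xn.
  by rewrite fr' ?fr //; apply: contra xn; apply: sr.
by rewrite fc' ?fc //; apply: contra xn; apply: sc.
Qed.

End Frame.

(** * One round *)

(** Worst-case number of steps of a loop-free command; the default value 1 is meant for atomic
    commands. *)
Fixpoint cost (c : cmd) : nat :=
  match c with
  | CSeq c1 c2 => (cost c1 + cost c2).+1
  | CIf _ c1 c2 => (maxn (cost c1) (cost c2)).+1
  | _ => 1
  end.

Local Notation "c1 ';;' c2" := (CSeq c1 c2) (at level 60, right associativity).

(* Registers: 0 n, 1 one, 2 cube root of n, 3 sample size, 4 number of
   rounds, 5 total number of samples, 6 position in the samples, 7 position in
   the output, 22 zero.  Arrays: 0 adjacency, 1 output, 2 samples,
   3 representatives, 4 marks of the removed vertices, 5 for each representative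
   r, the representative of the vertices that the current sample vertex splits
   off the class of r (n as long as there is none). *)
Definition reset_body : cmd := CWrite 3 12 22.

(** A vertex that agrees with its representative keeps it; the first one of a class to disagree
    founds a new class, which the later ones join. One increasing pass suffices: a representative is
    the smallest vertex of its class, so its entry of array 5 is reset before the others consult
    it. *)
Definition refine_body : cmd :=
  CRead 16 4 12 ;; CIf 16 CSkip (
    CWrite 5 12 0 ;; CRead 17 3 12 ;;
    COp OpAdd 18 15 12 ;; CRead 18 0 18 ;;
    COp OpAdd 19 15 17 ;; CRead 19 0 19 ;;
    COp OpEq 20 18 19 ;; CIf 20 CSkip (
      CRead 21 5 17 ;; COp OpEq 20 21 0 ;;
      CIf 20 (CWrite 5 17 12 ;; CWrite 3 12 12) (CWrite 3 12 21))).

Definition sample_body : cmd :=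
  CRead 14 2 6 ;; COp OpAdd 6 6 1 ;; CRead 16 4 14 ;;
  CIf 16 CSkip (COp OpMul 15 14 0 ;; for_loop 12 13 0 refine_body).

Definition remove_body : cmd :=
  CRead 16 4 12 ;; CIf 16 CSkip (
    CRead 17 3 12 ;; COp OpEq 20 17 12 ;; CIf 20 CSkip (
      CWrite 1 7 12 ;; COp OpAdd 7 7 1 ;; CWrite 1 7 17 ;; COp OpAdd 7 7 1 ;;
      CWrite 4 12 1)).

Definition block : cmd :=
  for_loop 12 13 0 reset_body ;; for_loop 10 11 3 sample_body ;;
  for_loop 12 13 0 remove_body.

(** * Correctness and running time of one round *)

Section Block.
Variables (R : realType) (w n : nat) (G : sgraph 'I_n) (samples : seq 'I_n).
Hypotheses (n_gt1 : 1 < n) (n3_small : n * n * n < 2 ^ w).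
Implicit Types (A : {set 'I_n}) (s : seq 'I_n) (st : state).

Definition base st : Prop :=
  [/\ reg st 0 = n, reg st 1 = 1, reg st 22 = 0,
      forall u v : 'I_n, cell st 0 (u * n + v) = adj G u v &
      forall j, cell st 2 j = nth 0 (map val samples) j].

Definition alive A st : Prop := forall v : 'I_n, cell st 4 v = (v \notin A).

Definition reps A s st : Prop := {in A, forall v : 'I_n,
  exists2 r : 'I_n, cell st 3 v = r & is_rep G A s v r}.

Lemma base_frame rs cs st st' : frame rs cs st st' ->
  0 \notin rs -> 1 \notin rs -> 22 \notin rs -> 0 \notin cs -> 2 \notin cs ->
  base st -> base st'.
Proof.
move=> [fr fc] r0 r1 r22 c0 c2 [? ? ? ? ?].
by split=> *; rewrite ?fr ?fc.
Qed.

Lemma alive_frame rs cs st st' A : frame rs cs st st' -> 4 \notin cs ->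
  alive A st -> alive A st'.
Proof. by move=> [fr fc] h hA v; rewrite fc. Qed.

Lemma small_lt m : m <= n * n * n -> m < 2 ^ w.
Proof. by move=> h; apply: leq_ltn_trans n3_small. Qed.

Lemma n_small : n < 2 ^ w. Proof. by apply: small_lt; nia. Qed.
Lemma one_small : 1 < 2 ^ w. Proof. by apply: small_lt; nia. Qed.
Lemma bool_small (b : bool) : b < 2 ^ w.
Proof. by apply: small_lt; case: b; nia. Qed.

Hypothesis samples_small : size samples < 2 ^ w.

(** On the empty sample all vertices agree, so vertex 0, as long as it is present, represents them
    all. *)
Lemma runs_reset A st : base st ->
  (forall z : 'I_n, z = 0 :> nat -> z \in A) ->
  runs R w (n * (cost reset_body + 5) + 5) (for_loop 12 13 0 reset_body) st
    (fun st' => frame [:: 12; 13] [:: 3] st st' /\ reps A [::] st').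
Proof.
move=> hb zA.
apply: (@runs_for _ _ (fun j st' => frame [:: 12; 13] [:: 3] st st' /\
    forall v : 'I_n, v < j -> cell st' 3 v = 0)) => //.
- exact: n_small.
- exact: one_small.
- by move=> j st' [/base_frame/(_ _ _ _ _ _ hb)[]].
- by move=> j st' v [f h]; split; split => //; apply: frame_reg f.
- move=> j st' jn [f h] Ei.
  have [_ _ E22 _ _] := base_frame f isT isT isT isT isT hb.
  apply: (@runs_write _ _ _ _ _ j 0) => //; split => //.
  split; first exact: frame_mem f.
  by move=> v vj; rewrite /= /upd /=; case: eqP => // /eqP vj'; apply: h; lia.
move=> st' [f h]; split => // v vA.
have n0 : 0 < n by lia.
exists (Ordinal n0); first by rewrite h.
by split=> //; apply: zA.
Qed.

(** Meaning of the entry [q] of array 5 at [r] once the vertices below [j] have been visited. In the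
    second case [u] is minimal among all disagreeing vertices of the class, not only the visited
    ones, and so represents the new class. *)
Definition splits_off A s x j (r : 'I_n) q : Prop :=
  (q = n /\ {in A, forall u : 'I_n, u < j -> same_trace G A s u r ->
                   adj G x u = adj G x r}) \/
  (exists u : 'I_n, [/\ q = u, u \in A, u < j,
    same_trace G A s u r /\ adj G x u != adj G x r & {in A, forall u' : 'I_n,
      same_trace G A s u' r -> adj G x u' != adj G x r -> u <= u'}]).

(** Loop invariant of a refinement pass: it interpolates between [reps A s] at [j = 0] and
    [reps A (rcons s x)] at [j = n]. *)
Definition refining A s x j (rep new : nat -> nat) : Prop :=
  {in A, forall v : 'I_n, exists2 r : 'I_n, rep v = r &
     is_rep G A (if v < j then rcons s x else s) v r} /\
  {in A, forall r : 'I_n, r < j -> is_rep G A s r r ->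
     splits_off A s x j r (new r)}.

Lemma refining_skip A s x (v : 'I_n) rep new : v \notin A ->
  refining A s x v rep new -> refining A s x v.+1 rep new.
Proof.
move=> vA [hrep hspl].
have nv u : u \in A -> (u < v.+1) = (u < v).
  move=> uA; rewrite ltnS leq_eqVlt; case: eqP => //= uv.
  by move: vA; rewrite -(val_inj uv) uA.
split=> [u uA|r rA]; first by rewrite nv //; apply: hrep.
rewrite nv // => rv rr; case: (hspl r rA rv rr) => [[E h]|[u [E uA uv tr mn]]].
  by left; split => // u uA; rewrite nv //; apply: h.
by right; exists u; split => //; apply: ltnW.
Qed.

(** * Processing one vertex of a refinement pass *)

Section RefineStep.
Variables (A : {set 'I_n}) (s : seq 'I_n) (x v r : 'I_n) (rep new : nat -> nat).
Hypotheses (xA : x \in A) (vA : v \in A).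
Hypotheses (ref : refining A s x v rep new) (Er : rep v = r).

Let rep_v : is_rep G A s v r.
Proof.
have [r' Er'] := ref.1 v vA; rewrite ltnn.
by have -> : r = r' by apply: val_inj; rewrite -[LHS]Er.
Qed.

Let new_r : r != v -> splits_off A s x v r (new r).
Proof.
have [rA tr mn] := rep_v; move=> rv; apply: ref.2 => //.
  by rewrite ltn_neqAle rv mn // same_trace_refl.
exact: is_rep_transfer (same_trace_sym tr) rep_v.
Qed.

Lemma refining_reps (rep' : nat -> nat) (r' : 'I_n) :
  rep' v = r' -> (forall u : 'I_n, u != v -> rep' u = rep u) ->
  is_rep G A (rcons s x) v r' ->
  {in A, forall u : 'I_n, exists2 r : 'I_n, rep' u = r &
     is_rep G A (if u < v.+1 then rcons s x else s) u r}.
Proof.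
move=> Ev Eu hv u uA; case: (eqVneq u v) => [->|uv].
  by rewrite ltnSn; exists r'.
have [r'' E h] := ref.1 u uA; exists r''; first by rewrite Eu.
by rewrite ltnS leq_eqVlt (inj_eq val_inj) (negbTE uv).
Qed.

(** If [v] is itself a representative, no other vertex of its class has been visited, which
    justifies the entry [n]. Classes other than those of [v] and [r] do not contain [v], so their
    entries stay correct. *)
Lemma refining_splits (new' : nat -> nat) :
  new' v = n ->
  (forall u : 'I_n, u != v -> u != r -> new' u = new u) ->
  (r != v -> splits_off A s x v.+1 r (new' r)) ->
  {in A, forall r' : 'I_n, r' < v.+1 -> is_rep G A s r' r' ->
     splits_off A s x v.+1 r' (new' r')}.
Proof.
move=> Ev Eu hr r' r'A r'v rr'; case: (eqVneq r' v) => [r'E|r'v'].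
  rewrite r'E in rr' *; left; split => // u uA uv uvtr.
  have [_ _ /(_ u uA uvtr) vu] := rr'.
  by have -> : u = v by apply: val_inj; apply/eqP; rewrite eqn_leq -ltnS uv vu.
case: (eqVneq r' r) => [r'E|r'r]; first by rewrite r'E; apply: hr; rewrite -r'E.
have r'v2 : r' < v by rewrite ltn_neqAle (inj_eq val_inj) r'v' -ltnS.
rewrite Eu //; case: (ref.2 r' r'A r'v2 rr') => [[E h]|[u [E uA uv tr mn]]].
  left; split => // u uA; rewrite ltnS leq_eqVlt (inj_eq val_inj) => /orP[/eqP-> tr|].
    case/eqP: r'r; apply: is_rep_inj rep_v.
    exact: is_rep_transfer (same_trace_sym tr) rr'.
  exact: h.
by right; exists u; split => //; apply: ltnW.
Qed.

Lemma refining_keep : adj G x v = adj G x r ->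
  refining A s x v.+1 rep (upd new v n).
Proof.
move=> xv; have [rA tr mn] := rep_v; split.
  apply: refining_reps => //; first exact: Er.
  split => //; first by rewrite same_trace_rcons // tr xv /=.
  by move=> u uA; rewrite same_trace_rcons // => /andP[utr _]; apply: mn.
apply: refining_splits.
- by rewrite /upd eqxx.
- by move=> u uv _; rewrite /upd (inj_eq val_inj) (negbTE uv).
move=> rv; rewrite /upd (inj_eq val_inj) (negbTE rv).
case: (new_r rv) => [[E h]|[u [E uA uv utr umn]]].
  left; split => // u uA; rewrite ltnS leq_eqVlt (inj_eq val_inj) => /orP[/eqP->//|].
  exact: h.
by right; exists u; split => //; apply: ltnW.
Qed.

(** The entry [n] says that all smaller vertices of the class agree with [r] on [x], so [v] is the
    least one to disagree. *)
Lemma refining_new : adj G x v != adj G x r -> new r = n ->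
  refining A s x v.+1 (upd rep v v) (upd (upd new v n) r v).
Proof.
move=> xv newr; have [rA tr mn] := rep_v.
have rv : r != v by apply: contraNneq xv => ->.
have h : {in A, forall u : 'I_n, u < v -> same_trace G A s u r ->
                   adj G x u = adj G x r}.
  (* The second alternative would make [n] an element of ['I_n]. *)
  case: (new_r rv) => [[]//|[u [E]]].
  by move: (ltn_ord u); rewrite -E newr ltnn.
split.
  apply: (@refining_reps _ v).
  - by rewrite /upd eqxx.
  - by move=> u uv; rewrite /upd (inj_eq val_inj) (negbTE uv).
  split => //; first exact: same_trace_refl.
  move=> u uA; rewrite same_trace_rcons // => /andP[utr /eqP xu].
  rewrite leqNgt; apply: contra xv => uv; rewrite -xu; apply/eqP/h => //.
  exact: same_trace_trans utr (same_trace_sym tr).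
apply: refining_splits.
- by rewrite /upd eqxx eq_sym (inj_eq val_inj) (negbTE rv).
- by move=> u uv ur; rewrite /upd !(inj_eq val_inj) (negbTE uv) (negbTE ur).
move=> _; rewrite /upd eqxx; right; exists v; split => //.
  by split => //; apply: same_trace_sym.
move=> u uA utr xu; rewrite leqNgt; apply: contra xu => uv.
by apply/eqP/h.
Qed.

(** Adjacency is Boolean: [v] and the founder [q] both disagree with [r] on [x], hence agree with
    each other. *)
Lemma refining_join : adj G x v != adj G x r -> new r != n ->
  refining A s x v.+1 (upd rep v (new r)) (upd new v n).
Proof.
move=> xv newr; have [rA tr mn] := rep_v.
have rv : r != v by apply: contraNneq xv => ->.
case: (new_r rv) => [[E _]|[q [E qA qv [qtr xq] qmn]]].
  by rewrite E eqxx in newr.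
split.
  apply: (@refining_reps _ q).
  - by rewrite /upd eqxx.
  - by move=> u uv; rewrite /upd (inj_eq val_inj) (negbTE uv).
  split => //.
    rewrite same_trace_rcons // (same_trace_trans qtr tr) /=.
    by move: xv xq; case: (adj G x v); case: (adj G x r); case: (adj G x q).
  move=> u uA; rewrite same_trace_rcons // => /andP[utr /eqP xu].
  apply: qmn => //; last by rewrite xu.
  exact: same_trace_trans utr (same_trace_sym tr).
apply: refining_splits.
- by rewrite /upd eqxx.
- by move=> u uv _; rewrite /upd (inj_eq val_inj) (negbTE uv).
move=> _; rewrite /upd (inj_eq val_inj) (negbTE rv) E; right; exists q.
by split => //; apply: ltnW.
Qed.

End RefineStep.

Lemma runs_refine A s x st : base st -> alive A st -> reps A s st ->
  x \in A -> reg st 15 = x * n ->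
  runs R w (n * (cost refine_body + 5) + 5) (for_loop 12 13 0 refine_body) st
    (fun st' =>
       frame [:: 12; 13; 16; 17; 18; 19; 20; 21] [:: 3; 5] st st' /\
       reps A (rcons s x) st').
Proof.
move=> hb hA hr xA E15.
pose rs := [:: 12; 13; 16; 17; 18; 19; 20; 21].
apply: (@runs_for _ _ (fun j st' => frame rs [:: 3; 5] st st' /\
    refining A s x j (cell st' 3) (cell st' 5))) => //.
- exact: n_small.
- exact: one_small.
- by move=> j st' [/base_frame/(_ _ _ _ _ _ hb)[]].
- by move=> j st' v [f h]; split; split => //; apply: frame_reg f.
- move=> j st' jn; pose v := Ordinal jn; rewrite -[j]/(val v) => -[f ref] E12.
  have [E0 E1 E22 Eadj _] := base_frame f isT isT isT isT isT hb.
  have E15' : reg st' 15 = x * n by rewrite f.1.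
  have Edead := alive_frame f isT hA v.
  apply: runs_seq; apply: (@runs_read _ _ _ _ _ (v \notin A)).
    by rewrite E12 Edead.
  apply: runs_if; rewrite /= /upd /= eqb0 negbK.
  case: (boolP (v \in A)) => vA /=; last first.
    apply: runs_skip; split => //; split; first exact: frame_reg f.
    exact: (@refining_skip A s x v).
  have [r Er _] := ref.1 v vA.
  have adj_small (u : 'I_n) : x * n + u < 2 ^ w.
    by apply: small_lt; have := ltn_ord x; have := ltn_ord u; nia.
  apply: runs_seq; apply: (@runs_write _ _ _ _ _ v n); [by []|by []|].
  apply: runs_seq; apply: (@runs_read _ _ _ _ _ r).
    by rewrite /= /upd /= E12.
  apply: runs_seq; apply: (@runs_op _ _ _ _ _ _ (x * n + v)) => //.
    by rewrite /= /upd /= E12 E15'.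
  apply: runs_seq; apply: (@runs_read _ _ _ _ _ (adj G x v)).
    exact: (Eadj x v).
  apply: runs_seq; apply: (@runs_op _ _ _ _ _ _ (x * n + r)) => //.
    by rewrite /= /upd /= E15'.
  apply: runs_seq; apply: (@runs_read _ _ _ _ _ (adj G x r)).
    exact: (Eadj x r).
  apply: runs_seq; apply: (@runs_op _ _ _ _ _ _ (adj G x v == adj G x r)).
  - by rewrite /= /upd /=; case: (adj G x v); case: (adj G x r).
  - exact: bool_small.
  apply: runs_if; rewrite /= eqb0 negbK.
  case: (eqVneq (adj G x v) (adj G x r)) => [xv|xv].
    apply: runs_skip; split; last by [].
    split; first by do ![apply: frame_reg => // | apply: frame_mem => //].
    exact: (@refining_keep A s x v r).
  (* Hence the entry of array 5 read next is not the one just reset at [j]. *)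
  have rv : (r == j :> nat) = false.
    by apply/eqP => rj; case/eqP: xv; congr adj; apply: val_inj.
  apply: runs_seq; apply: (@runs_read _ _ _ _ _ (cell st' 5 r)).
    by rewrite /= /upd /= rv.
  apply: runs_seq; apply: (@runs_op _ _ _ _ _ _ (cell st' 5 r == n)).
  - by rewrite /= /upd /= E0.
  - exact: bool_small.
  apply: runs_if; rewrite /= eqb0 negbK.
  case: (eqVneq (cell st' 5 r) n) => [newr|newr].
    apply: runs_seq; apply: (@runs_write _ _ _ _ _ r v); [by []|by []|].
    apply: (@runs_write _ _ _ _ _ v v); [by []|by []|].
    split; last by [].
    split; first by do ![apply: frame_reg => // | apply: frame_mem => //].
    exact: (@refining_new A s x v r).
  apply: (@runs_write _ _ _ _ _ v (cell st' 5 r)); [by []|by []|].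
  split; last by [].
  split; first by do ![apply: frame_reg => // | apply: frame_mem => //].
  exact: (@refining_join A s x v r).
move=> st' [f [h _]]; split => // v vA; have [r Er] := h v vA.
by rewrite ltn_ord; exists r.
Qed.

Lemma runs_samples A t p st : base st -> alive A st -> reps A [::] st ->
  reg st 3 = t -> reg st 6 = p -> p + t <= size samples ->
  runs R w (t * (n * (cost refine_body + 5) + 20) + 5)
    (for_loop 10 11 3 sample_body) st
    (fun st' => [/\
       frame [:: 6; 10; 11; 12; 13; 14; 15; 16; 17; 18; 19; 20; 21] [:: 3; 5]
             st st',
       reg st' 6 = p + t & reps A (take t (drop p samples)) st']).
Proof.
move=> hb hA hr E3 E6 pt.
pose rs := [:: 6; 10; 11; 12; 13; 14; 15; 16; 17; 18; 19; 20; 21].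
have -> : n * (cost refine_body + 5) + 20 =
  n * (cost refine_body + 5) + 5 + 10 + 5 by lia.
apply: (@runs_for _ _ (fun j st' => [/\ frame rs [:: 3; 5] st st',
    reg st' 6 = p + j & reps A (take j (drop p samples)) st'])) => //.
- by apply: leq_ltn_trans samples_small; lia.
- exact: one_small.
- move=> j st' [f _ _]; rewrite f.1 //.
  by have [_ ->] := base_frame f isT isT isT isT isT hb.
- by move=> j st' v [f h1 h2]; split; split => //; apply: frame_reg f.
- move=> j st' jt [f E6' hr'] E10.
  have hb' := base_frame f isT isT isT isT isT hb.
  have [E0 E1 E22 Eadj Esam] := hb'.
  have hA' := alive_frame f isT hA.
  have x0 : 'I_n := Ordinal (ltnW n_gt1).
  set x := nth x0 samples (p + j).
  have pj : p + j < size samples by lia.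
  have Ex : cell st' 2 (p + j) = x by rewrite Esam (nth_map x0).
  have Etake : take j.+1 (drop p samples) = rcons (take j (drop p samples)) x.
    by rewrite (take_nth x0) ?nth_drop // size_drop; lia.
  apply: (@runs_le _ _ (1 + (1 + (1 + (maxn 1
    (1 + (n * (cost refine_body + 5) + 5)).+1).+1).+1).+1).+1); first lia.
  apply: runs_seq; apply: (@runs_read _ _ _ _ _ x); first by rewrite E6'.
  apply: runs_seq; apply: (@runs_op _ _ _ _ _ _ (p + j.+1)).
  - by rewrite /= /upd /= E6' E1 addn1 addnS.
  - by apply: leq_ltn_trans samples_small; lia.
  apply: runs_seq; apply: (@runs_read _ _ _ _ _ (x \notin A)).
    exact: hA'.
  apply: runs_if; rewrite /= /upd /= eqb0 negbK.
  case: (boolP (x \in A)) => xA /=; last first.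
    (* A sample vertex that has already been removed changes no trace. *)
    apply: runs_skip; split => //; split => //.
      by do ![apply: frame_reg => //].
    move=> v vA; have [r Er hrv] := hr' v vA; exists r => //.
    case: hrv => rA tr mn; rewrite Etake; split => //.
      by rewrite same_trace_rcons_notin.
    by move=> u uA; rewrite same_trace_rcons_notin //; apply: mn.
  apply: runs_seq; apply: (@runs_op _ _ _ _ _ _ (x * n)).
  - by rewrite /= /upd /= E0.
  - by apply: small_lt; have := ltn_ord x; nia.
  set st1 := set_reg _ 15 _.
  have f1 : frame rs [:: 3; 5] st st1 by do ![apply: frame_reg => //].
  apply: runs_weaken (@runs_refine A (take j (drop p samples)) x st1 _ _ _ xA _)
    (leqnn _) _ => //.
  move=> st2 [f2 hr2]; split; last by rewrite f2.1.
  rewrite Etake; split => //; last by rewrite f2.1.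
  by apply: (frame_trans _ _ f1 f2); apply/allP.
- by split => //; rewrite ?addn0 ?take0.
Qed.

Definition written (L : seq ('I_n * 'I_n)) st : Prop :=
  [seq (nat_of_ord p.1, nat_of_ord p.2) | p <- L] =
  [seq (cell st 1 (2 * i), cell st 1 (2 * i + 1)) | i <- iota 0 (size L)].

Definition progress W L A st : Prop :=
  [/\ alive A st, reg st 7 = 2 * size L, written L st & sd_prefix G W L A].

Lemma written_rcons L (u v : 'I_n) st st' : written L st ->
  cell st' 1 = upd (upd (cell st 1) (2 * size L) u) (2 * size L).+1 v ->
  written (rcons L (u, v)) st'.
Proof.
rewrite /written => h E; rewrite map_rcons size_rcons.
rewrite -[(size L).+1]addn1 iotaD cats1 map_rcons h.
rewrite E add0n /upd addn1 !eqxx (ltn_eqF (ltnSn _)); congr rcons.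
apply/eq_in_map => i; rewrite mem_iota => /andP[_ iL].
have ne a : a < 2 * size L ->
    (a == (2 * size L).+1 = false) * (a == 2 * size L = false).
  by move=> aL; rewrite !ltn_eqF //; lia.
by rewrite !ne //; lia.
Qed.

(** The partner of a removed vertex is its representative, which survives and so is still present.
    The vertices present lie in [A], hence the distinguishers in [A] bound the width of the new
    pair. *)
Lemma runs_remove W L A s st : base st -> reps A s st -> progress W L A st ->
  {in A &, forall u v, same_trace G A s u v -> #|distinguishers G A u v| <= W} ->
  runs R w (n * (cost remove_body + 5) + 5) (for_loop 12 13 0 remove_body) st
    (fun st' => frame [:: 7; 12; 13; 16; 17; 20] [:: 1; 4] st st' /\
       exists L', progress W L' (survivors G A s) st').
Proof.
move=> hb hr hp sep.
(* The vertices still present once those below [j] have been visited. *)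
pose B j := [set v in A | (v \in survivors G A s) || (j <= v)].
have memB j (u : 'I_n) :
    (u \in B j) = (u \in A) && ((u \in survivors G A s) || (j <= u)).
  by rewrite [LHS]in_set.
have B_stay (v : 'I_n) : (v \in A -> v \in survivors G A s) -> B v.+1 = B v.
  move=> h; apply/setP => u; rewrite !memB.
  case: (eqVneq u v) => [->|uv].
    by case: (boolP (v \in A)) => //= /h ->.
  by rewrite [v <= u]leq_eqVlt [_ == _ :> nat]eq_sym (inj_eq val_inj) (negbTE uv).
apply: (@runs_for _ _ (fun j st' =>
    frame [:: 7; 12; 13; 16; 17; 20] [:: 1; 4] st st' /\
    exists L', progress W L' (B j) st')) => //.
- exact: n_small.
- exact: one_small.
- by move=> j st' [/base_frame/(_ _ _ _ _ _ hb)[]].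
- by move=> j st' v [f [L' h]]; split; (split; [exact: frame_reg f|exists L']).
- move=> j st' jn [f [L' [hA E7 hw hpre]]] E12; pose v := Ordinal jn.
  have [E0 E1 E22 _ _] := base_frame f isT isT isT isT isT hb.
  have vB : (v \in B j) = (v \in A) by rewrite memB leqnn orbT andbT.
  apply: runs_seq; apply: (@runs_read _ _ _ _ _ (v \notin A)).
    by rewrite E12 -vB; apply: (hA v).
  apply: runs_if; rewrite /= /upd /= eqb0 negbK.
  case: (boolP (v \in A)) => vA /=; last first.
    apply: runs_skip; split => //; split; first exact: frame_reg f.
    by exists L'; rewrite (B_stay v) // (negbTE vA).
  have [r Er rep_r] := hr v vA; have [rA rtr _] := rep_r.
  have vS := mem_survivors vA rep_r.
  apply: runs_seq; apply: (@runs_read _ _ _ _ _ r).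
    by rewrite /= /upd /= E12 f.2 // -Er.
  apply: runs_seq; apply: (@runs_op _ _ _ _ _ _ (r == v)).
  - by rewrite /= /upd /= E12 -[j]/(val v) (inj_eq val_inj).
  - exact: bool_small.
  apply: runs_if; rewrite /= eqb0 negbK.
  case: (eqVneq r v) => [rv|rv].
    apply: runs_skip; split => //; split; first by do 3![apply: frame_reg => //].
    by exists L'; rewrite (B_stay v) // => _; rewrite vS rv.
  have rB : r \in B j by rewrite memB rA (rep_survives rep_r).
  have L_small : 2 * size L' + 2 < 2 ^ w.
    apply: small_lt; have := sd_prefix_size hpre.
    have : 0 < #|B j| by apply/card_gt0P; exists r.
    by nia.
  apply: runs_seq; apply: (@runs_write _ _ _ _ _ (2 * size L') v) => //.
  apply: runs_seq; apply: (@runs_op _ _ _ _ _ _ (2 * size L').+1).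
  - by rewrite /= /upd /= E7 E1 addn1.
  - by apply: leq_ltn_trans L_small; lia.
  apply: runs_seq; apply: (@runs_write _ _ _ _ _ (2 * size L').+1 r) => //.
  apply: runs_seq; apply: (@runs_op _ _ _ _ _ _ (2 * (size L').+1)).
  - by rewrite /= /upd /= E1 addn1 mulnS.
  - by apply: leq_ltn_trans L_small; lia.
  apply: (@runs_write _ _ _ _ _ v 1) => //; split => //; split.
    by do ![apply: frame_reg => // | apply: frame_mem => //].
  have BE : B j.+1 = B j :\ v.
    apply/setP => u; rewrite in_setD1 !memB.
    case: (eqVneq u v) => [->|uv] /=.
      by rewrite vS (negbTE rv) ltnn andbF.
    by rewrite [j <= u]leq_eqVlt [_ == _ :> nat]eq_sym -[j]/(val v) (inj_eq val_inj)
               (negbTE uv).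
  exists (rcons L' (v, r)); rewrite BE; split.
  - move=> u; rewrite /= /upd /= -[j]/(val v) (inj_eq val_inj) in_setD1.
    by case: (eqVneq u v) => //= _; apply: hA.
  - by rewrite size_rcons.
  - exact: written_rcons hw _.
  apply: sd_prefix_rcons => //; first by rewrite vB.
    by rewrite eq_sym.
  apply: leq_trans (sep v r vA rA (same_trace_sym rtr)).
  by apply: sd_in_le_distinguishers; apply/subsetP => u; rewrite memB => /andP[].
- split; first exact: frame_refl; exists L.
  by have -> : B 0 = A by apply/setP => u; rewrite inE leq0n orbT andbT.
move=> st' [f [L' h]]; split => //; exists L'.
suff <- : B n = survivors G A s by [].
apply/setP => u; rewrite memB leqNgt ltn_ord orbF.
by case: (boolP (u \in survivors _ _ _)) => [/(subsetP (survivors_sub _ _ _))->|];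
  rewrite ?andbF.
Qed.

(** The factor [t.+1] also pays for the reset and removal passes, which take place even when
    [t = 0]. *)
Lemma runs_block W L A t p st : base st -> progress W L A st ->
  (forall z : 'I_n, z = 0 :> nat -> z \in A) ->
  reg st 3 = t -> reg st 6 = p -> p + t <= size samples ->
  separates G W A (take t (drop p samples)) ->
  runs R w (100 * (n * t.+1)) block st (fun st' => [/\
     frame [:: 6; 7; 10; 11; 12; 13; 14; 15; 16; 17; 18; 19; 20; 21]
           [:: 1; 3; 4; 5] st st',
     reg st' 6 = p + t &
     exists L', progress W L' (survivors G A (take t (drop p samples))) st']).
Proof.
move=> hb hp zA E3 E6 pt sep.
apply: (@runs_le _ _ ((n * (cost reset_body + 5) + 5) +
   ((t * (n * (cost refine_body + 5) + 20) + 5) +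
    (n * (cost remove_body + 5) + 5)).+1).+1).
  by rewrite /=; nia.
apply: runs_seq; apply: runs_weaken (runs_reset hb zA) (leqnn _) _.
move=> st1 [f1 hr1]; have hb1 := base_frame f1 isT isT isT isT isT hb.
have [hA E7 hw hpre] := hp.
apply: runs_seq; apply: runs_weaken
  (@runs_samples A t p st1 hb1 (alive_frame f1 isT hA) hr1 _ _ pt) (leqnn _) _.
- by rewrite f1.1.
- by rewrite f1.1.
move=> st2 [f2 E62 hr2]; have hb2 := base_frame f2 isT isT isT isT isT hb1.
have hp2 : progress W L A st2.
  split => //; first exact: alive_frame f2 isT (alive_frame f1 isT hA).
  - by rewrite f2.1 // f1.1.
  - by rewrite /written f2.2 // f1.2.
apply: runs_weaken (runs_remove hb2 hr2 hp2 _) (leqnn _) _.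
  by move=> u v uA vA; apply/implyP; move/forall_inP/(_ u uA)/forall_inP: sep; apply.
move=> st3 [f3 hp3]; split => //; last by rewrite f3.1.
apply: (frame_trans _ _ (frame_trans _ _ (frame_trans _ _ (frame_refl _ _ _) f1) f2) f3);
  exact/allP.
Qed.

End Block.

(** * The program *)

(** The cube root rounded up: the [i] with [i^3 < n] form an initial segment of this length. The
    machine computes it by the same count. *)
Definition croot (n : nat) : nat := count (fun i => i * i * i < n) (iota 0 n).

(** For the last bound, [m.-1 ^ 3 < n] by minimality of [m], and [m <= 2 * m.-1] since [m] is at
    least 2. *)
Lemma crootP n : 1 < n ->
  [/\ 1 < croot n, croot n <= n, n <= croot n * croot n * croot n &
      croot n * croot n * croot n <= 8 * n].
Proof.
move=> n1; have ex : exists m, n <= m * m * m by exists n; nia.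
case: (ex_minnP ex) => m nm mmin.
have mn : m <= n by apply: mmin; nia.
have -> : croot n = m.
  rewrite /croot -(subnKC mn) iotaD count_cat add0n subnKC //.
  have /eqP-> : count (fun i => i * i * i < n) (iota 0 m) == size (iota 0 m).
    rewrite -all_count; apply/allP => i; rewrite mem_iota add0n => /andP[_ im].
    by rewrite ltnNge; apply/negP => /mmin; lia.
  have /negbTE : ~~ has (fun i => i * i * i < n) (iota m (n - m)).
    apply/hasPn => i; rewrite mem_iota => /andP[mi _].
    by rewrite -leqNgt (leq_trans nm) // !leq_mul.
  by rewrite has_count lt0n => /eqP->; rewrite size_iota addn0.
have m1 : 1 < m by rewrite ltnNge; apply/negP => m1; nia.
split => //; have : ~~ (n <= m.-1 * m.-1 * m.-1).
  by apply/negP => /mmin; lia.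
have [m' ->] : exists m', m = m'.+2 by exists m.-2; lia.
by rewrite -ltnNge /=; nia.
Qed.

Definition root_body : cmd :=
  COp OpMul 14 12 12 ;; COp OpMul 14 14 12 ;; COp OpLt 14 14 0 ;; COp OpAdd 2 2 14.

Definition prologue (a : nat) : cmd :=
  CConst 1 1 ;; for_loop 12 13 0 root_body ;; COp OpMul 3 2 2 ;;
  CConst 4 a ;; COp OpMul 4 4 3 ;; COp OpMul 5 4 3 ;; CConst 8 0 ;; COp OpLt 9 8 5.

Definition draw_body : cmd :=
  CSeq (CRand 14 0 ;; CWrite 2 8 14) (COp OpAdd 8 8 1 ;; COp OpLt 9 8 5).

(** The last block runs with sample size 0: all remaining vertices form one class and are removed,
    except vertex 0. *)
Definition epilogue : cmd := for_loop 8 9 4 block ;; CConst 3 0 ;; block.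

Definition program (a : nat) : cmd :=
  prologue a ;; CWhile 9 draw_body ;; epilogue.

(** * Drawing the samples and running all rounds *)

Section Program.
Variables (R : realType) (w n : nat) (G : sgraph 'I_n).
Hypotheses (n_gt1 : 1 < n) (n3_small : n * n * n < 2 ^ w).
Implicit Types (st : state) (samples : seq 'I_n) (A : {set 'I_n}).

Lemma prob_det t c k st k' st' Post : step w c k st = [:: (k', st')] ->
  prob_within R w t.+1 Post (c :: k) st = prob_within R w t Post k' st'.
Proof. by move=> E; rewrite /= E big_seq1 divr1. Qed.

Lemma prob_seq t c1 c2 k st Post :
  prob_within R w t.+1 Post (CSeq c1 c2 :: k) st =
  prob_within R w t Post (c1 :: c2 :: k) st.
Proof. exact: prob_det. Qed.

Lemma prob_rand t k st Post x y : reg st y = n ->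
  prob_within R w t.+1 Post (CRand x y :: k) st =
  ((\sum_(i < n) prob_within R w t Post k (set_reg st x i)) / n%:R)%R.
Proof.
move=> E; have En : maxn 1 n = n by lia.
rewrite /= E En size_map size_iota big_map; congr (_ / _)%R.
by rewrite -[X in iota 0 X]subn0 big_mkord.
Qed.

Definition sampled samples st st' : Prop :=
  frame [:: 8; 9; 14] [:: 2] st st' /\
  forall j, cell st' 2 j = nth 0 (map val samples) j.

(** Here [g] bounds the success probability once the samples are fixed, and the induction is on the
    number [m] of draws still to be made. One draw costs 8 steps and the exit test 1. *)
Lemma prob_draw (g : seq 'I_n -> R) M T Post k st m samples st' :
  M < 2 ^ w -> reg st 0 = n -> reg st 1 = 1 -> reg st 5 = M ->
  (forall samples st', size samples = M -> sampled samples st st' ->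
     (g samples <= prob_within R w T Post k st')%R) ->
  sampled samples st st' -> size samples + m = M ->
  reg st' 8 = size samples -> reg st' 9 = (size samples < M) ->
  (avg m (fun s => g (samples ++ s)) <=
   prob_within R w (m * 8 + 1 + T) Post (CWhile 9 draw_body :: k) st')%R.
Proof.
move=> Mw E0 E1 E5 Hg; elim: m samples st' => [|m IH] samples st' hs szM E8 E9.
  rewrite [avg _ _]/= cats0 mul0n add0n add1n.
  rewrite (@prob_det _ _ _ _ k st'); last by rewrite /= E9 -szM addn0 ltnn.
  by apply: Hg => //; rewrite -szM addn0.
have -> : m.+1 * 8 + 1 + T =
  (1 + (1 + 1).+1 + (m * 8 + 1 + T)).+4 by lia.
have sM : size samples < M by lia.
rewrite (@prob_det _ _ _ _ (draw_body :: CWhile 9 draw_body :: k) st'); last first.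
  by rewrite /= E9 sM.
rewrite /draw_body !prob_seq -/draw_body.
have [fr fc] := hs.1.
rewrite prob_rand ?fr //= ler_wpM2r ?invr_ge0 ?ler0n //; apply: ler_sum => i _.
have one_small := one_small n_gt1 n3_small.
have [st1 [hs1 E81 E91] H1] : runs R w (1 + (1 + 1).+1).+1
    (CWrite 2 8 14 ;; COp OpAdd 8 8 1 ;; COp OpLt 9 8 5) (set_reg st' 14 i)
    (fun st1 => [/\ sampled (rcons samples i) st st1,
       reg st1 8 = (size samples).+1 & reg st1 9 = ((size samples).+1 < M)]).
  apply: runs_seq; apply: (@runs_write _ _ _ _ _ (size samples) i) => //.
  apply: runs_seq; apply: (@runs_op _ _ _ _ _ _ (size samples).+1).
  - by rewrite /= /upd /= E8 fr // E1 addn1.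
  - exact: leq_ltn_trans Mw.
  apply: (@runs_op _ _ _ _ _ _ ((size samples).+1 < M)).
  - by rewrite /= /upd /= fr // E5.
  - exact: (bool_small n_gt1 n3_small).
  split => //; split.
    by do ![apply: frame_reg => // | apply: frame_mem => //]; exact: hs.1.
  move=> j; rewrite /= /upd /= map_rcons nth_rcons size_map hs.2.
  case: eqP => [->|/eqP js]; first by rewrite ltnn.
  by case: ltnP => // sj; rewrite nth_default // size_map.
have := H1 Post (CWhile 9 draw_body :: k) (m * 8 + 1 + T).
rewrite addSn prob_seq => H2; apply: le_trans H2.
have E s : g (samples ++ i :: s) = g (rcons samples i ++ s) by rewrite cat_rcons.
under eq_avg => s _ do rewrite E.
by apply: IH; rewrite ?size_rcons // addSnnS.
Qed.

(** Vertex 0 is the smallest of its class in every round, which keeps [runs_reset] applicable. *)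
Lemma survivors0 A samples : (forall z : 'I_n, z = 0 :> nat -> z \in A) ->
  forall z : 'I_n, z = 0 :> nat -> z \in survivors G A samples.
Proof.
move=> zA z z0; rewrite inE zA //=; apply/forall_inP => u _.
by rewrite z0 leq0n implybT.
Qed.

Lemma survivors_nil A : (forall z : 'I_n, z = 0 :> nat -> z \in A) ->
  survivors G A [::] = [set Ordinal (ltnW n_gt1)].
Proof.
move=> zA; apply/setP => u; rewrite in_set1; apply/idP/eqP => [|->]; last first.
  exact: survivors0.
have z0 : Ordinal (ltnW n_gt1) \in A by apply: zA.
rewrite inE => /andP[_ /forall_inP/(_ _ z0)] /= u0.
by apply/val_inj/eqP; rewrite -leqn0.
Qed.

Definition solved W st : Prop := exists L : seq ('I_n * 'I_n),
  [/\ outputs st L, sd_degeneracy_seq L & sd_width G L <= W].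

Lemma runs_epilogue W th t N samples st :
  size samples = N * t -> N * t < 2 ^ w -> N < 2 ^ w -> th <= W ->
  base G samples st -> reg st 3 = t -> reg st 4 = N -> reg st 6 = 0 ->
  reg st 7 = 0 -> (forall j, cell st 4 j = 0) ->
  well_sampled G W th t N [set: 'I_n] samples ->
  runs R w (N * (100 * (n * t.+1) + 5) + 100 * n + 10) epilogue st (solved W).
Proof.
move=> szs Ntw Nw thW hb E3 E4 E6 E7 E4c good.
have samples_small : size samples < 2 ^ w by rewrite szs.
have one_small := one_small n_gt1 n3_small.
pose rs := [:: 6; 7; 8; 9; 10; 11; 12; 13; 14; 15; 16; 17; 18; 19; 20; 21].
pose cs := [:: 1; 3; 4; 5].
apply: (@runs_le _ _ (N * (100 * (n * t.+1) + 5) + 5 + (1 + 100 * (n * 1)).+1).+1).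
  lia.
apply: runs_seq; apply: (@runs_for _ _ (fun j st' =>
    [/\ frame rs cs st st', reg st' 6 = j * t &
     exists A L, [/\ progress G W L A st', forall z : 'I_n, z = 0 :> nat -> z \in A &
       well_sampled G W th t (N - j) A (drop (j * t) samples)]])) => //.
- move=> j st' [f _ _]; rewrite !f.1 // E4; split => //.
  by have [_ ->] := hb.
- move=> j st' v [f E6' [A [L [h1 h2 h3]]]].
  by split; split => //; [exact: frame_reg f|exists A, L|exact: frame_reg f|exists A, L].
- move=> j st' jN [f E6' [A [L [hp zA goodj]]]] E8.
  have EN : N - j = (N - j.+1).+1 by lia.
  move: goodj; rewrite EN => /andP[sep good'].
  have hb' : base G samples st' by apply: base_frame f _ _ _ _ _ hb.
  apply: runs_weaken (@runs_block R w n G samples n_gt1 n3_small samples_small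
     W L A t (j * t) st' hb' hp zA _ E6' _ sep) (leqnn _) _.
  + by rewrite f.1.
  + by rewrite szs -mulSnr leq_mul2r jN orbT.
  move=> st2 [f2 E62 [L2 hp2]]; split; last by rewrite f2.1.
  split; [by apply: (frame_trans _ _ f f2); apply/allP|by rewrite E62 -mulSnr|].
  exists (survivors G A (take t (drop (j * t) samples))), L2; split => //.
    exact: survivors0.
  by move: good'; rewrite drop_drop mulSn.
- split; [exact: frame_refl|by rewrite E6|].
  exists [set: 'I_n], [::]; split; [|by move=> z _; rewrite inE
                                    |by rewrite subn0 drop0].
  split => //; last exact: sd_prefix_nil.
  by move=> v; rewrite E4c inE.
move=> st1 [f E61 [A [L [hp zA]]]]; rewrite subnn => Ath.
apply: runs_seq; apply: runs_const; first exact: ltnW.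
set st2 := set_reg _ _ _.
have hb2 : base G samples st2.
  have [? ? ? ? ?] : base G samples st1 by apply: base_frame f _ _ _ _ _ hb.
  by split.
apply: runs_weaken (@runs_block R w n G samples n_gt1 n3_small samples_small
     W L A 0 (N * t) st2 hb2 hp zA _ E61 _ _) (leqnn _) _.
- by [].
- by rewrite addn0 szs.
(* At most [th] vertices are left, so no pair of them has more than [W] distinguishers, whatever the
   order of removal. *)
- apply/forall_inP => u uA; apply/forall_inP => v vA; apply/implyP => _.
  apply: leq_trans thW; apply: leq_trans Ath; apply: subset_leq_card.
  by apply/subsetP => x; rewrite inE => /andP[].
move=> st3 [_ _ [L3 [_ _ hw]]]; rewrite take0 (survivors_nil zA) => hpre.
have [deg wid] := sd_prefix_total hpre; exists L3; split => //.
by move: hw; rewrite /written /outputs; case: deg => ->; rewrite card_ord.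
Qed.

(** Division with remainder by [n] recovers [u] and [v] from the index. *)
Lemma input_state_adj (u v : 'I_n) :
  cell (input_state G) 0 (u * n + v) = adj G u v.
Proof.
rewrite /=; congr nat_of_bool.
apply/existsP/idP => [[u' /existsP[v' /andP[/eqP E a]]]|a].
  suff [-> ->] : u = u' /\ v = v' by [].
  have n0 : 0 < n by apply: ltnW.
  have Ed : (u * n + v) %/ n = (u' * n + v') %/ n by rewrite E.
  have Em : (u * n + v) %% n = (u' * n + v') %% n by rewrite E.
  move: Ed Em; rewrite !divnMDl // !modnMDl !modn_small // !divn_small // !addn0.
  by move=> Eu Ev; split; apply: val_inj.
by exists u; apply/existsP; exists v; rewrite eqxx.
Qed.

Lemma runs_prologue a (t := croot n * croot n) :
  a * t * t < 2 ^ w -> a < 2 ^ w ->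
  runs R w (n * (cost root_body + 5) + 25) (prologue a) (input_state G)
    (fun st => [/\ frame [:: 1; 2; 3; 4; 5; 8; 9; 12; 13; 14] [::]
                     (input_state G) st,
       reg st 1 = 1, reg st 3 = t, reg st 4 = a * t /\ reg st 5 = a * t * t &
       reg st 8 = 0 /\ reg st 9 = (0 < a * t * t)]).
Proof.
move=> Mw aw; have [k1 kn _ _] := crootP n_gt1.
have one_small := one_small n_gt1 n3_small.
have n_small := n_small n_gt1 n3_small.
have t0 : 0 < t by rewrite muln_gt0; lia.
pose fr := frame [:: 1; 2; 3; 4; 5; 8; 9; 12; 13; 14] [::] (input_state G).
apply: (@runs_le _ _ (1 + ((n * (cost root_body + 5) + 5) +
   (1 + (1 + (1 + (1 + (1 + 1).+1).+1).+1).+1).+1).+1).+1); first lia.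
apply: runs_seq; apply: runs_const => //.
apply: runs_seq; apply: (@runs_for _ _ (fun j st => [/\ fr st, reg st 1 = 1 &
    reg st 2 = count (fun i => i * i * i < n) (iota 0 j)])) => //.
- by move=> j st [f E1 _]; rewrite f.1.
- by move=> j st v [f E1 E2]; split; split => //; apply: frame_reg f.
- move=> j st jn [f E1 E2] E12; have E0 : reg st 0 = n by rewrite f.1.
  apply: runs_seq; apply: (@runs_op _ _ _ _ _ _ (j * j)).
  + by rewrite /= E12.
  + apply: (small_lt n3_small); apply: (@leq_trans (n * n));
      last by rewrite leq_pmulr; lia.
    by rewrite leq_mul // ltnW.
  apply: runs_seq; apply: (@runs_op _ _ _ _ _ _ (j * j * j)).
  + by rewrite /= /upd /= E12.
  + by apply: (small_lt n3_small); rewrite !leq_mul // ltnW.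
  apply: runs_seq; apply: (@runs_op _ _ _ _ _ _ (j * j * j < n)).
  + by rewrite /= /upd /= E0.
  + exact: (bool_small n_gt1 n3_small).
  apply: (@runs_op _ _ _ _ _ _ (count (fun i => i * i * i < n) (iota 0 j.+1))).
  + by rewrite -[j.+1]addn1 iotaD count_cat /= /upd /= E2 addn0 add0n.
  + apply: leq_ltn_trans (count_size _ _) _; rewrite size_iota.
    exact: leq_ltn_trans n_small.
  by split => //; split => //; do ![apply: frame_reg => //].
- by split => //; apply: frame_reg => //; apply: frame_refl.
move=> st [f E1 E2]; have {}E2 : reg st 2 = croot n by [].
apply: runs_seq; apply: (@runs_op _ _ _ _ _ _ t).
- by rewrite /= E2.
- apply: (small_lt n3_small); apply: (@leq_trans (n * n));
      last by rewrite leq_pmulr; lia.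
  exact: leq_mul.
apply: runs_seq; apply: runs_const => //.
apply: runs_seq; apply: (@runs_op _ _ _ _ _ _ (a * t)) => //.
  by apply: leq_ltn_trans Mw; nia.
apply: runs_seq; apply: (@runs_op _ _ _ _ _ _ (a * t * t)) => //.
apply: runs_seq; apply: runs_const; first exact: ltnW.
apply: (@runs_op _ _ _ _ _ _ (0 < a * t * t)) => //.
  exact: (bool_small n_gt1 n3_small).
by split => //; do ![apply: frame_reg => //].
Qed.

(** Only the drawing loop is random; after it, a well-sampled sequence leads to success with
    certainty. The dominant costs are [a * t * t] draws and [a * t] rounds of [O(n * t)] steps. *)
Lemma prob_program a W th (t := croot n * croot n) :
  a * t * t < 2 ^ w -> a < 2 ^ w -> th <= W ->
  (avg (a * t * t)
     (fun s => (well_sampled G W th t (a * t) [set: 'I_n] s)%:R) <=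
   prob_within R w (1000 * (a.+1 * (n * (t * t)))) (solved W)
     [:: program a] (input_state G))%R.
Proof.
move=> Mw aw thW; have [k1 kn _ _] := crootP n_gt1.
have t1 : 0 < t by rewrite muln_gt0; lia.
have [st [f E1 E3 [E4 E5] [E8 E9]] H] := runs_prologue Mw aw.
pose Te := a * t * (100 * (n * t.+1) + 5) + 100 * n + 10.
apply: (@le_trans _ _ (prob_within R w ((n * (cost root_body + 5) + 25) +
   (a * t * t * 8 + 1 + (Te + 0)).+1).+1 (solved W) [:: program a] (input_state G)));
  last first.
  apply: prob_within_mono; rewrite /Te /= {H Mw}; clearbody t.
  have tt : 0 < t * t by rewrite muln_gt0 t1.
  have h1 : n <= n * (t * t) by rewrite leq_pmulr.
  have h2 : a * (t * t) <= a * (n * (t * t)).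
    by rewrite leq_mul2l leq_pmull ?orbT //; lia.
  have h3 : a * (n * t) <= a * (n * (t * t)).
    by rewrite leq_mul2l leq_mul2l leq_pmull ?orbT.
  have h4 : a * t <= a * (t * t) by rewrite leq_mul2l leq_pmull ?orbT.
  by lia.
rewrite prob_seq; apply: le_trans (H _ _ _).
rewrite prob_seq.
have E0 : reg st 0 = n by rewrite f.1.
apply: (@prob_draw (fun s => (well_sampled G W th t (a * t) [set: 'I_n] s)%:R)%R
   (a * t * t) _ _ _ st (a * t * t) [::] st) => //; last first.
  by split => // j; rewrite f.2 //= nth_nil.
move=> s st' szs [f' Es].
case: (boolP (well_sampled _ _ _ _ _ _ _)) => [good|_]; last first.
  exact: prob_within_ge0.
have hb : base G s st'.
  split => //; rewrite ?f'.1 // ?f.1 // => u v; rewrite f'.2 // f.2 //.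
  exact: input_state_adj.
have atw : a * t < 2 ^ w by apply: leq_ltn_trans Mw; nia.
have [st2 solved2 H2] : runs R w Te epilogue st' (solved W).
  apply: (runs_epilogue szs Mw atw thW hb _ _ _ _ _ good).
  - by rewrite f'.1.
  - by rewrite f'.1.
  - by rewrite f'.1 // f.1.
  - by rewrite f'.1 // f.1.
  - by move=> j; rewrite f'.2 // f.2.
apply: le_trans (H2 _ _ _); rewrite /=.
by case: asboolP.
Qed.

End Program.

(** * Bounds on the failure probability *)

Local Open Scope ring_scope.

(** * Expected shrinking in one round *)

Section Contraction.
Variables (R : realType) (n : nat) (G : sgraph 'I_n).

(** From [expR y >= 1 + y] and [(1 + y) * (1 - y / 2) >= 1] on the unit interval. *)
Lemma expRN_le_half (y : R) : 0 <= y <= 1 -> expR (- y) <= 1 - y / 2.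
Proof.
move=> /andP[y0 y1]; rewrite expRN -[leRHS]invrK lef_pV2 ?posrE ?expR_gt0 //;
  last by rewrite invr_gt0; lra.
apply: le_trans (expR_ge1Dx y); rewrite -[leLHS]mul1r ler_pdivrMr; last lra.
by nra.
Qed.

(** From [expR (2 * x) >= 1 + 2 * x] and [(1 + 2 * x) * (1 - x) >= 1]. *)
Lemma onem_ge_expR (x : R) : 0 <= x <= 2^-1 -> expR (- (2 * x)) <= 1 - x.
Proof.
move=> /andP[x0 x1]; rewrite expRN -[leRHS]invrK lef_pV2 ?posrE ?expR_gt0 //;
  last by rewrite invr_gt0; lra.
apply: le_trans (expR_ge1Dx _); rewrite -[leLHS]mul1r ler_pdivrMr; last lra.
by nra.
Qed.

Lemma sum_nat_count (I : Type) (r : seq I) (P : pred I) :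
  \sum_(i <- r) (P i)%:R = (count P r)%:R :> R.
Proof.
by elim: r => [|i r IH]; rewrite ?big_nil // big_cons IH -natrD.
Qed.

(* [expR (|A| / k)] contracts because, in expectation, a constant fraction of
   [k] disjoint close pairs is not separated by the sample. *)
Lemma survivors_contract (k b : nat) (A : {set 'I_n})
    (p := expR (- (16 * (b + 4))%:R) : R) :
  (0 < n)%N -> (0 < k)%N -> (k * k * k <= 8 * n)%N -> (sd G <= b * k)%N ->
  (2 * (b + 4) * k < #|A|)%N ->
  avg (k * k) (fun s => expR (k%:R^-1 * #|survivors G A s|%:R)) <=
  (1 - p / 2) * expR (k%:R^-1 * #|A|%:R).
Proof.
move=> n0 k0 k8 sdb cA.
have sdG : sd_at_most G (sd G) by rewrite /sd; case: ex_minnP.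
have kA : (2 * k <= #|A|)%N by nia.
have [ps [sz un sub close]] := disjoint_close_pairs sdG kA.
have kR : 0 < k%:R :> R by rewrite ltr0n.
have nR : 0 < n%:R :> R by rewrite ltr0n.
pose cnt s := count (fun q => same_trace G A s q.1 q.2) ps.
(* Every agreeing pair costs a vertex, and [expR (- y) <= 1 - y / 2] applies to [y = cnt s / k], as
   there are only [k] pairs. *)
apply: (@le_trans _ _ (avg (k * k) (fun s => expR (k%:R^-1 * #|A|%:R) *
    (1 + - (2 * k%:R)^-1 * (cnt s)%:R)))).
  apply: le_avg => s _; have := count_agreeing_le G s un sub; rewrite -/(cnt s).
  rewrite -(ler_nat R) natrD => cle.
  apply: (@le_trans _ _ (expR (k%:R^-1 * #|A|%:R + - ((cnt s)%:R / k%:R)))).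
    rewrite ler_expR [_ / _]mulrC -mulrBr ler_wpM2l ?invr_ge0 ?ler0n //.
    by rewrite lerBrDr addrC.
  rewrite expRD ler_wpM2l ?expR_ge0 //; apply: le_trans (expRN_le_half _) _.
    rewrite divr_ge0 ?ler0n //= ler_pdivrMr // mul1r ler_nat -sz.
    exact: count_size.
  by rewrite le_eqVlt; apply/orP; left; apply/eqP; field; rewrite lt0r_neq0.
rewrite avgZ avgD avg_cst // avgZ mulrC ler_wpM2r ?expR_ge0 // mulNr lerD2l lerN2.
under eq_avg => s _ do rewrite -sum_nat_count.
rewrite avg_sum.
suff : \sum_(q <- ps) p <= \sum_(q <- ps) avg (k * k) (fun s =>
    (same_trace G A s q.1 q.2)%:R).
  rewrite big_const_seq count_predT sz iter_addr addr0 -[p *+ k]mulr_natr => h.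
  apply: le_trans (ler_wpM2l _ h); last by rewrite invr_ge0 mulr_ge0.
  by rewrite le_eqVlt; apply/orP; left; apply/eqP; field; rewrite lt0r_neq0.
rewrite big_seq [leRHS]big_seq; apply: ler_sum => q qps.
rewrite avg_avoid //; set d := #|_|.
have dk : (d <= (b + 4) * k)%N.
  by apply: leq_trans (close q qps) _; nia.
have An : (#|A| <= n)%N by apply: leq_trans (max_card _) _; rewrite card_ord.
have x0 : 0 <= d%:R / n%:R :> R by rewrite divr_ge0.
(* Indeed [2 * d <= 2 * (b + 4) * k < #|A| <= n]. *)
have x1 : d%:R / n%:R <= 2^-1 :> R.
  rewrite ler_pdivrMr // mulrC ler_pdivlMr // -natrM ler_nat.
  by nia.
have := @onem_ge_expR (d%:R / n%:R); rewrite x0 x1 => /(_ isT) hx.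
(* The exponent [2 * k^2 * d / n] is at most [2 * (b + 4) * k^3 / n], hence at most [16 * (b + 4)]
   by [k^3 <= 8 * n]. *)
apply: le_trans (lerXn2r (k * k) _ _ hx); rewrite ?nnegrE ?expR_ge0 //; last lra.
rewrite -expRM_natl ler_expR mulrN lerN2 mulrCA mulrA mulrA ler_pdivrMr //.
rewrite -!natrM ler_nat.
apply: (@leq_trans (2 * (k * k) * ((b + 4) * k))); first by rewrite leq_mul.
have -> : (2 * (k * k) * ((b + 4) * k) = 2 * (b + 4) * (k * k * k))%N by lia.
have -> : (16 * (b + 4) * n = 2 * (b + 4) * (8 * n))%N by lia.
by rewrite leq_mul.
Qed.

End Contraction.

(** * Numerical estimates *)

Section FailureProbability.
Variable R : realType.

Lemma cube_rootK (n : nat) : (n%:R `^ (1 / 3)) ^+ 3 = n%:R :> R.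
Proof.
by rewrite -powR_mulrn ?powR_ge0 // -powRrM mul1r mulVf ?powRr1 ?ler0n.
Qed.

Lemma ln_nat_ge_half (n : nat) : (1 < n)%N -> 2^-1 <= ln n%:R :> R.
Proof.
move=> n1; have n0 : 0 < n%:R :> R by rewrite ltr0n ltnW.
rewrite -ler_expR lnK ?posrE //; apply: (@le_trans _ _ 2); last by rewrite ler_nat.
have : expR (- 2^-1) >= 2^-1 :> R.
  by apply: le_trans (expR_ge1Dx _); lra.
by rewrite expRN lef_pV2 ?posrE ?expR_gt0.
Qed.

(** The product [n * k^4] is at most [y^3 * (2 * y)^4 = 16 * y^7]; the constant 32 compensates for
    [ln n] being possibly as small as one half. *)
Lemma time_bound (n k B : nat) (y := n%:R `^ (1 / 3) : R) :
  (1 < n)%N -> k%:R <= 2 * y ->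
  (B * (n * (k * k * (k * k))) <=
   Num.truncn (32 * B%:R * n%:R `^ (7 / 3) * ln n%:R : R))%N.
Proof.
move=> n1 ky; have L := ln_nat_ge_half n1.
have y0 : 0 <= y by apply: powR_ge0.
have Ey : y ^+ 3 = n%:R by apply: cube_rootK.
have E7 : n%:R `^ (7 / 3) = y ^+ 7.
  by rewrite -powR_mulrn // /y -powRrM mul1r mulrC.
have y7 : 0 <= y ^+ 7 by rewrite exprn_ge0.
rewrite E7 truncn_ge_nat; last by rewrite !mulr_ge0 //; lra.
rewrite !natrM -[X in _ * (X * _) <= _]Ey.
apply: (@le_trans _ _ (32 * B%:R * y ^+ 7 * 2^-1)); last first.
  by rewrite ler_wpM2l // !mulr_ge0.
have kk : k%:R * k%:R * (k%:R * k%:R) <= (2 * y) * (2 * y) * ((2 * y) * (2 * y)).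
  by rewrite !ler_pM ?mulr_ge0.
have : y ^+ 3 * (k%:R * k%:R * (k%:R * k%:R)) <= 16 * y ^+ 7.
  apply: le_trans (ler_wpM2l _ kk) _; first by rewrite exprn_ge0.
  by rewrite le_eqVlt; apply/orP; left; apply/eqP; ring.
by move/(ler_wpM2l (ler0n R B)); lra.
Qed.

(** The power is at most [expR (- k^2 * d / n)], and [k^2 * d / n >= y^2 * (C * y * ln n) / y^3 = C
    * ln n]. *)
Lemma unseparated_le (n k d : nat) (C : R) (y := n%:R `^ (1 / 3)) :
  (1 < n)%N -> y <= k%:R -> (d <= n)%N -> C * y * ln n%:R <= d%:R -> 0 <= C ->
  (1 - d%:R / n%:R) ^+ (k * k) <= expR (- (C * ln n%:R)).
Proof.
move=> n1 yk dn Cd C0; have n0 : 0 < n%:R :> R by rewrite ltr0n ltnW.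
have y0 : 0 <= y by apply: powR_ge0.
have Ey : y ^+ 3 = n%:R by apply: cube_rootK.
apply: (@le_trans _ _ (expR (- (d%:R / n%:R)) ^+ (k * k))).
  apply: lerXn2r; rewrite ?nnegrE ?expR_ge0 ?expR_ge1Dx //.
  by rewrite subr_ge0 ler_pdivrMr // mul1r ler_nat.
rewrite -expRM_natl ler_expR mulrN lerN2 mulrA ler_pdivlMr // natrM.
have L0 : 0 <= ln n%:R :> R by apply: le_trans (ln_nat_ge_half n1); lra.
have -> : C * ln n%:R * n%:R = (y * y) * (C * y * ln n%:R).
  by rewrite -[X in _ * X = _]Ey; ring.
by rewrite ler_pM ?mulr_ge0 // ler_pM.
Qed.

(** With [t = k^2], the power is at most [expR (- (3 * c + 2) * t)] and the initial potential at
    most [expR t]. Of the remaining exponent, [3 * c * t] covers [c * ln n] because [ln n <= 3 * t],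
    and [expR (- t)] gives the factor one half. *)
Lemma slow_shrinking_le (n k a : nat) (c p : R) : (1 < n)%N -> (0 < k)%N ->
  (n <= k * k * k)%N -> 0 <= c -> 0 <= p <= 1 -> 2 * (3 * c + 2) <= p * a%:R ->
  (1 - p / 2) ^+ (a * (k * k)) * expR (k%:R^-1 * n%:R) <=
  expR (- (c * ln n%:R)) / 2.
Proof.
move=> n1 k0 nk c0 /andP[p0 p1] pa.
have n0 : 0 < n%:R :> R by rewrite ltr0n ltnW.
have kR : 1 <= k%:R :> R by rewrite ler1n.
set t := k%:R * k%:R :> R.
have kt : k%:R <= t by rewrite -[leLHS]mulr1 ler_wpM2l.
have nt : k%:R^-1 * n%:R <= t.
  rewrite mulrC ler_pdivrMr ?(lt_le_trans ltr01) // /t -!natrM ler_nat.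
  by [].
have Lt : ln n%:R <= 3 * t.
  apply: (@le_trans _ _ (3 * k%:R)); last by rewrite ler_wpM2l.
  rewrite -ler_expR lnK ?posrE // expRM_natl.
  apply: (@le_trans _ _ (k%:R ^+ 3)).
    by rewrite -natrX ler_nat; apply: leq_trans nk _; rewrite !expnS expn0; lia.
  apply: lerXn2r; rewrite ?nnegrE ?expR_ge0 ?ler0n //.
  by apply: le_trans (expR_ge1Dx _); lra.
have hq : (1 - p / 2) ^+ (a * (k * k)) <= expR (- (p / 2)) ^+ (a * (k * k)).
  apply: lerXn2r; rewrite ?nnegrE ?expR_ge0 ?expR_ge1Dx //; lra.
apply: (@le_trans _ _ (expR (- (p / 2)) ^+ (a * (k * k)) * expR t)).
  by apply: ler_pM => //; rewrite ?expR_ge0 ?exprn_ge0 ?ler_expR //; lra.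
rewrite -expRM_natl -expRD !natrM -/t.
apply: (@le_trans _ _ (expR (- (c * ln n%:R)) * expR (- t))).
  rewrite -expRD ler_expR; have t0 : 0 <= t by lra.
  have h1 : 2 * (3 * c + 2) * t <= p * a%:R * t by rewrite ler_wpM2r.
  have h2 : c * ln n%:R <= c * (3 * t) by rewrite ler_wpM2l.
  by nra.
rewrite ler_wpM2l ?expR_ge0 // expRN lef_pV2 ?posrE ?expR_gt0 //.
by apply: le_trans (expR_ge1Dx _); lra.
Qed.

(** Since [k <= n], the left factors are at most [a * n^4]. In the exponent, 4 cancels [n^4], [c]
    gives the target, and [4 * a] absorbs [2 * a] because [2 * a <= 4 * a * ln n]. *)
Lemma bad_sample_le (n k a : nat) (c : R) : (1 < n)%N -> (k <= n)%N ->
  (a * (k * k))%:R * (n%:R ^+ 2 * expR (- ((4 + c + 4 * a%:R) * ln n%:R))) <=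
  expR (- (c * ln n%:R)) / 2.
Proof.
move=> n1 kn; have n0 : 0 < n%:R :> R by rewrite ltr0n ltnW.
have L := ln_nat_ge_half n1; set l := ln n%:R in L *.
have En : n%:R = expR l by rewrite lnK ?posrE.
apply: (@le_trans _ _ (a%:R * (n%:R ^+ 4 * expR (- ((4 + c + 4 * a%:R) * l))))).
  rewrite [(a * (k * k))%:R]natrM -mulrA ler_wpM2l // mulrA ler_wpM2r ?expR_ge0 //.
  rewrite (_ : 4 = 2 + 2)%N // exprD ler_wpM2r ?exprn_ge0 // -natrX ler_nat.
  by rewrite !expnS expn0 muln1 leq_mul.
rewrite En -expRM_natl -expRD.
have -> : 4 * l - (4 + c + 4 * a%:R) * l = - (c * l) - 4 * a%:R * l by ring.
rewrite expRD mulrCA ler_wpM2l ?expR_ge0 // expRN ler_pdivrMr ?expR_gt0 //.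
have h : 4 * a%:R * l <= expR (4 * a%:R * l).
  by apply: le_trans (expR_ge1Dx _); lra.
rewrite ler_pdivlMl //; apply: le_trans h.
have : 0 <= a%:R :> R by []. 
by nra.
Qed.

End FailureProbability.

(** The constant is absorbed by the word length: [a + 1 <= 2^a <= n^a]. *)
Lemma word_bits_large (a n : nat) : (1 < n)%N ->
  (a.+1 * n ^ 5 <= 2 ^ word_bits (a + 5) n)%N.
Proof.
move=> n1; rewrite /word_bits [((a + 5) * _)%N]mulnC expnM.
have h : (n <= 2 ^ up_log 2 n)%N by apply: up_logP.
apply: (@leq_trans (n ^ (a + 5))%N); last by rewrite leq_exp2r // addnS.
rewrite expnD leq_mul2r; apply/orP; right.
apply: leq_trans (ltn_expl a (ltnSn 1)) _.
by case: a => // a; rewrite leq_exp2r.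
Qed.

Lemma word_bits_bounds (a k n : nat) (w := word_bits (a + 5) n) :
  (1 < n)%N -> (k <= n)%N ->
  [/\ n * n * n < 2 ^ w, a < 2 ^ w & a * (k * k) * (k * k) < 2 ^ w]%N.
Proof.
move=> n1 kn; have large := word_bits_large a n1.
have n4 : (n ^ 4 < n ^ 5)%N by rewrite ltn_exp2l.
split; apply: leq_trans large.
- apply: (@leq_trans (n ^ 5)%N); last by rewrite leq_pmull.
  by apply: leq_ltn_trans n4; rewrite !expnS expn0 muln1 -mulnA leq_pmull // ltnW.
- by rewrite leq_pmulr // expn_gt0 ltnW.
apply: (@leq_ltn_trans (a * n ^ 4)%N).
  by rewrite -mulnA leq_mul // !expnS expn0 muln1 !mulnA !leq_mul.
by apply: leq_ltn_trans (_ : a.+1 * n ^ 4 < _)%N; rewrite ?leq_mul // ltn_pmul2l.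
Qed.

Theorem theorem5p1 (R : realType) (c beta : R) (hc : 0 < c) :
  exists (P : cmd) (K : nat) (Ctime Cwidth : R),
    forall (n : nat) (G : sgraph 'I_n),
      (2 <= n)%N ->
      (sd G)%:R <= beta * n%:R `^ (1 / 3) ->
      1 - n%:R `^ (- c) <=
        prob_within R (word_bits K n)
          (Num.truncn (Ctime * n%:R `^ (7 / 3) * ln n%:R))
          (fun st => exists s : seq ('I_n * 'I_n),
             [/\ outputs st s,
                 sd_degeneracy_seq s &
                 (sd_width G s)%:R <= Cwidth * n%:R `^ (1 / 3) * ln n%:R])
          [:: P] (input_state G).
Proof.
(* All constants depend on [c] and [beta] only: [b] bounds [beta], [p] is the agreement probability
   of a close pair, [a] makes the rounds suffice, [Cw] is the exponent for the union bound, and the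
   extra term of [Cwidth] covers the final block. *)
pose b := (Num.truncn `|beta|).+1.
pose p : R := expR (- (16 * (b + 4))%:R).
pose a := (Num.truncn (2 * (3 * c + 2) / p)).+1.
pose Cw : R := 4 + c + 4 * a%:R.
pose Cwidth : R := Cw + 8 * (b + 4)%:R.
have p0 : 0 < p by apply: expR_gt0.
have p1 : p <= 1 by rewrite -expR0 ler_expR oppr_le0.
have bbeta : beta <= b%:R by apply: le_trans (ler_norm _) (ltW (truncnS_gt _)).
have pa : 2 * (3 * c + 2) <= p * a%:R.
  by rewrite [p * _]mulrC -ler_pdivrMr //; apply/ltW/truncnS_gt.
have a0 : 0 < a%:R :> R by rewrite ltr0n.
have Cw0 : 0 <= Cw by rewrite /Cw; lra.
have CwCwidth : Cw <= Cwidth by rewrite lerDl.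
clearbody a b.
exists (program a), (a + 5)%N, (32 * (1000 * a.+1)%:R), Cwidth => n G n1 sdG.
have [k1 kn nk k8] := crootP n1; set k := croot n in k1 kn nk k8.
set y := n%:R `^ (1 / 3) in sdG *; set L := ln n%:R.
have n0 : 0 < n%:R :> R by rewrite ltr0n ltnW.
have L2 : 2^-1 <= L by apply: ln_nat_ge_half.
have L0 : 0 <= L by lra.
have y0 : 0 <= y by apply: powR_ge0.
have Ey : y ^+ 3 = n%:R by apply: cube_rootK.
have yk : y <= k%:R.
  rewrite -(@ler_pXn2r _ 3) ?nnegrE // Ey -natrX ler_nat.
  by rewrite !expnS expn0 muln1 mulnA.
have ky : k%:R <= 2 * y.
  rewrite -(@ler_pXn2r _ 3) ?nnegrE ?mulr_ge0 // exprMn Ey -!natrX -natrM ler_nat.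
  by rewrite !expnS expn0 !muln1 mulnA.
have sdbk : (sd G <= b * k)%N.
  rewrite -(ler_nat R) natrM; apply: le_trans sdG _.
  apply: (@le_trans _ _ (b%:R * y)); first by rewrite ler_wpM2r.
  by rewrite ler_wpM2l.
pose W := Num.truncn (Cwidth * y * L); pose th := (2 * (b + 4) * k)%N.
have width0 : 0 <= Cwidth * y * L.
  by rewrite mulr_ge0 // ?mulr_ge0 //; lra.
(* From [k <= 2 * y] and [L >= 1 / 2], [th] is at most [8 * (b + 4) * y * L]. *)
have thW : (th <= W)%N.
  rewrite truncn_ge_nat // /th !natrM.
  apply: (@le_trans _ _ (8 * (b + 4)%:R * y * 2^-1)).
    have h : 0 <= (b + 4)%:R :> R by [].
    have : (b + 4)%:R * k%:R <= (b + 4)%:R * (2 * y) by rewrite ler_wpM2l.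
    by lra.
  apply: ler_pM => //; first by rewrite !mulr_ge0.
  by rewrite ler_wpM2r // lerDr.
have [n3_small aw Mw] := word_bits_bounds a n1 kn.
(* Half of the allowed failure probability goes to too many vertices being left, half to some round
   failing to separate a far pair. *)
apply: (@le_trans _ _ (avg (a * (k * k) * (k * k)) (fun s =>
  (well_sampled G W th (k * k) (a * (k * k)) [set: 'I_n] s)%:R))).
  pose eps := expR (- (Cw * L)).
  apply: le_trans (@well_sampled_ge R n G (ltnW n1) W th (k * k) (a * (k * k))
    (1 - p / 2) (n%:R ^+ 2 * eps) k%:R^-1 [set: 'I_n] _ _ _ _); last first.
  - by move=> A cA; apply: survivors_contract => //; apply: ltnW.
  - move=> A; apply: separates_fail_le; [exact: ltnW| |exact: expR_ge0].
    move=> d /andP[Wd dn]; apply: unseparated_le => //.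
    apply: (@le_trans _ _ (Cwidth * y * L)).
      by rewrite ler_wpM2r // ler_wpM2r.
    by apply: le_trans (ltW (truncnS_gt _)) _; rewrite ler_nat.
  - by rewrite invr_ge0.
  - lra.
  rewrite cardsT card_ord.
  have h1 : (1 - p / 2) ^+ (a * (k * k)) * expR (k%:R^-1 * n%:R) <=
      expR (- (c * L)) / 2.
    by apply: slow_shrinking_le pa => //; rewrite ?(ltW p0) ?p1 ?(ltW hc) // ltnW.
  have h2 := bad_sample_le a c n1 kn; rewrite -/Cw -/L -/eps in h2.
  have -> : n%:R `^ (- c) = expR (- (c * L)).
    by rewrite /powR gt_eqF // mulNr.
  by lra.
apply: le_trans (@prob_program R _ n G n1 n3_small a W th Mw aw thW) _.
rewrite -/k; apply: (@le_trans _ _ (prob_within R (word_bits (a + 5) n)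
  (Num.truncn (32 * (1000 * a.+1)%:R * n%:R `^ (7 / 3) * L)) (solved G W)
  [:: program a] (input_state G))); last first.
  apply: prob_within_imp => st [s [out deg wid]]; exists s; split => //.
  by apply: le_trans (_ : W%:R <= _); rewrite ?ler_nat // truncn_le.
apply: prob_within_mono.
by rewrite mulnA; apply: time_bound.
Qed.
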